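(* Let $T$ be a complete first-order theory with monster model $\mathfrak{C}$, and let $\alpha,\beta$ be small ordinals. Suppose that $(\alpha,\beta,G,H,\langle V_n,U_n\mid n<\omega\rangle,\cdot,X,* )$ is a bounded $F_\sigma$ action and that $Y\subseteq\mathfrak{C}^\alpha$ is a pseudo strong Choquet set contained in $X$ which is $E_G^X$-invariant. Suppose also that for some shifty $a\in Y$ the relation $E_G^X\upharpoonright G*a$ is not strongly closed (i.e. there is no $n<\omega$ with $E_G^X\cap(G*a)^2=U_n\cap(G*a)^2$). Then $|Y/E_G^X|\geq2^{\aleph_0}$.
   Context: $\mathfrak{C}$ is a monster model of $T$: $\kappa$-saturated and $\kappa$-homogeneous for a big cardinal $\kappa$ (much larger than the size of the language). ''Small'' means of cardinality $<\kappa$; all parameter sets and models ($M\prec\mathfrak{C}$) are small. A set is pseudo $F_\sigma$ if it is a countable union of sets each type definable over some small set. $\emptyset$-invariant means invariant under $\operatorname{Aut}(\mathfrak{C})$. An $F_\sigma$ action is a tuple $(\alpha,\beta,G,H,\langle V_n,U_n\mid n<\omega\rangle,\cdot,X,* )$ where: $H\subseteq\mathfrak{C}^\beta$ and $(H,\cdot)$ is an $\emptyset$-type definable group (both $H$ and the multiplication are $\emptyset$-type definable); $G\leq H$ is an $\emptyset$-invariant pseudo $F_\sigma$ subgroup, $G=\bigcup_{n<\omega}V_n$ with $V_n$ $\emptyset$-type definable, $e\in V_n$, $V_n=V_n^{-1}$ and $V_n\cdot V_n\subseteq V_{n+1}$; $X\subseteq\mathfrak{C}^\alpha$ is $\emptyset$-type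 definable and $*$ is an $\emptyset$-type definable group action of $H$ on $X$; and $U_n=\{(a,b)\in X\times X\mid\exists g\in V_n\,(g*a=b)\}$. $E_G^X=\bigcup_nU_n$ is the orbit equivalence relation of the action of $G$ on $X$. The action is bounded if $|X/E_G^X|<\kappa$. $a\in X$ is shifty if one of the following holds: (1) (right shifty) for every $k<\omega$ there is $n<\omega$ such that for all $g_1,g_2\in H$, if $(g_1*a,g_2*a)\in U_k$ then $((g_1\cdot g_2^{-1})*a,a)\in U_n$; or (2) (left shifty) for every $k<\omega$ there is $n<\omega$ such that for all $g_1,g_2\in H$, if $(g_1*a,g_2*a)\in U_k$ then $((g_1^{-1}\cdot g_2)*a,a)\in U_n$, and if $((g_1^{-1}\cdot g_2)*a,a)\in U_k$ then $(g_1*a,g_2*a)\in U_n$. For a model $M$, $Y_M=\{\operatorname{tp}(a/M)\mid a\in Y\}\subseteq S_\alpha(M)$ with the topology induced from the Stone space. $Y$ is pseudo strong Choquet if $Y_M$ is a strong Choquet space for every model $M$. The strong Choquet game on a topological space $Z$: in round $n<\omega$, player A chooses an open set $O_n\subseteq W_{n-1}$ (where $W_{-1}=Z$) and a point $x_n\in O_n$, and player B responds with an open set $W_n\subseteq O_n$ containing $x_n$; player B wins if $\bigcap_{n<\omega}W_n\neq\emptyset$. $Z$ is strong Choquet if player B has a winning strategy. *)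

(* Defs.v *)
From HB Require Import structures.
From mathcomp Require Import all_boot all_classical topology.

Set Implicit Arguments.
Unset Strict Implicit.
Unset Printing Implicit Defensive.

Local Open Scope classical_set_scope.
Local Open Scope card_scope.

Record language : Type := Language {
  fun_sym : Type;
  rel_sym : Type;
  fun_arity : fun_sym -> nat;
  rel_arity : rel_sym -> nat
}.

Inductive term (L : language) (V : Type) : Type :=
| Var : V -> term L V
| App : forall f : fun_sym L, ('I_(fun_arity f) -> term L V) -> term L V.

(* [V] is the type of free variables; a quantifier binds the variable [None] of
   its body. Infinite tuples of variables and parameters are obtained by taking
   [V := I + A], with [I] indexing the tuple and [A] a set of parameters. *)
Inductive formula (L : language) (V : Type) : Type :=
| Bot : formula L V
| Eq : term L V -> term L V -> formula L V
| Rel : forall r : rel_sym L, ('I_(rel_arity r) -> term L V) -> formula L V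
| Imp : formula L V -> formula L V -> formula L V
| All : formula L (option V) -> formula L V.

Arguments Bot {L V}.

Definition Not (L : language) (V : Type) (phi : formula L V) : formula L V :=
  Imp phi Bot.

Definition And (L : language) (V : Type) (phi psi : formula L V) :
    formula L V :=
  Not (Imp phi (Not psi)).

Record structure (L : language) : Type := Structure {
  carrier :> Type;
  carrier_nonempty : inhabited carrier;
  fun_interp : forall f : fun_sym L, ('I_(fun_arity f) -> carrier) -> carrier;
  rel_interp : forall r : rel_sym L, ('I_(rel_arity r) -> carrier) -> Prop
}.

Fixpoint eval (L : language) (C : structure L) (V : Type) (s : V -> C)
    (t : term L V) : C :=
  match t with
  | Var v => s v
  | App f args => @fun_interp L C f (fun i => eval s (args i))
  end.

Fixpoint sat (L : language) (C : structure L) (V : Type) (phi : formula L V)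
    (s : V -> C) {struct phi} : Prop :=
  match phi with
  | Bot => False
  | Eq t u => eval s t = eval s u
  | Rel r args => @rel_interp L C r (fun i => eval s (args i))
  | Imp phi1 phi2 => sat phi1 s -> sat phi2 s
  | All psi =>
      forall c : C, sat psi (fun v => if v is Some w then s w else c)
  end.

Definition sentence (L : language) : Type := formula L void.

Definition holds (L : language) (C : structure L) (phi : sentence L) : Prop :=
  sat phi (@of_void C).

Definition models (L : language) (C : structure L) (T : set (sentence L)) :
    Prop :=
  forall phi, T phi -> holds C phi.

Definition entails (L : language) (T : set (sentence L)) (phi : sentence L) :
    Prop :=
  forall C : structure L, models C T -> holds C phi.

Definition complete_theory (L : language) (T : set (sentence L)) : Prop :=
  (exists C : structure L, models C T) /\
  (forall phi, entails T phi \/ entails T (Not phi)).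

(* A cardinal is given by a type [K] of that cardinality, and a small ordinal
   indexing tuples by an arbitrary index type smaller than [K]: the order of the
   coordinates plays no role. *)
Definition card_lt (S S' : Type) (A : set S) (B : set S') : Prop :=
  A #<= B /\ ~ (B #<= A).

Definition small (K S : Type) (A : set S) : Prop := card_lt A [set: K].

Definition tuple_cat (I J S : Type) (x : I -> S) (y : J -> S) : I + J -> S :=
  fun v => match v with inl i => x i | inr j => y j end.

Definition sat_over (L : language) (C : structure L) (A : set C) (I : Type)
    (phi : formula L (I + A)) (x : I -> C) : Prop :=
  sat phi (tuple_cat x (fun a : A => val a)).

Definition finitely_satisfiable (L : language) (C : structure L) (A : set C)
    (I : Type) (p : set (formula L (I + A))) : Prop :=
  forall q : set (formula L (I + A)), q `<=` p -> finite_set q ->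
    exists x : I -> C, forall phi, q phi -> sat_over phi x.

Definition saturated (K : Type) (L : language) (C : structure L) : Prop :=
  forall (A : set C) (p : set (formula L (unit + A))),
    small K A -> finitely_satisfiable p ->
    exists x : unit -> C, forall phi, p phi -> sat_over phi x.

Record automorphism (L : language) (C : structure L) (sigma : C -> C) : Prop :=
  Automorphism {
  aut_bij : bijective sigma;
  aut_fun : forall (f : fun_sym L) args,
    sigma (@fun_interp L C f args) = @fun_interp L C f (sigma \o args);
  aut_rel : forall (r : rel_sym L) args,
    @rel_interp L C r args <-> @rel_interp L C r (sigma \o args)
}.

Definition elementary_map (L : language) (C : structure L) (A : set C)
    (f : A -> C) : Prop :=
  forall phi : formula L A, sat phi (fun a : A => val a) <-> sat phi f.

(* Homogeneity in the strong form customary for monster models: small partial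
   elementary maps extend to automorphisms. *)
Definition homogeneous (K : Type) (L : language) (C : structure L) : Prop :=
  forall (A : set C) (f : A -> C), small K A -> elementary_map f ->
    exists2 sigma : C -> C, automorphism sigma &
      forall a : A, sigma (val a) = f a.

(* The requirement that the cardinal of [K] be much larger than the size of the
   language is read as 2 ^ (|L| + aleph_0) < |K|. *)
Record monster (K : Type) (L : language) (T : set (sentence L))
    (C : structure L) : Prop := Monster {
  monster_models : models C T;
  monster_big : small K [set: set (nat + fun_sym L + rel_sym L)];
  monster_saturated : saturated K C;
  monster_homogeneous : homogeneous K C
}.

Definition fun_closed (L : language) (C : structure L) (M : set C) : Prop :=
  forall (f : fun_sym L) (args : 'I_(fun_arity f) -> M),
    @fun_interp L C f (fun i => val (args i)) \in M.

Definition substructure (L : language) (C : structure L) (M : set C)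
    (M0 : inhabited M) (Mf : fun_closed M) : structure L :=
  @Structure L M M0
    (fun f args => exist (fun c => c \in M) _ (@Mf f args))
    (fun r args => @rel_interp L C r (fun i => val (args i))).

Definition elementary_substructure (L : language) (C : structure L)
    (M : set C) : Prop :=
  exists (M0 : inhabited M) (Mf : fun_closed M),
    forall (phi : formula L nat) (s : nat -> M),
      @sat L (substructure M0 Mf) nat phi s <->
      @sat L C nat phi (fun v => val (s v)).

Definition small_model (K : Type) (L : language) (C : structure L)
    (M : set C) : Prop :=
  small K M /\ elementary_substructure M.

Definition type_definable (L : language) (C : structure L) (A : set C)
    (I : Type) (X : set (I -> C)) : Prop :=
  exists p : set (formula L (I + A)),
    X = [set x | forall phi, p phi -> sat_over phi x].

Definition pseudo_Fsigma (K : Type) (L : language) (C : structure L)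
    (I : Type) (X : set (I -> C)) : Prop :=
  exists2 V : nat -> set (I -> C),
    (forall n, exists2 A : set C, small K A & type_definable A (V n)) &
    X = \bigcup_n V n.

Definition aut_invariant (L : language) (C : structure L) (I : Type)
    (X : set (I -> C)) : Prop :=
  forall sigma : C -> C, automorphism sigma ->
    forall x, X x <-> X (sigma \o x).

Definition complete_type (L : language) (C : structure L) (A : set C)
    (I : Type) (p : set (formula L (I + A))) : Prop :=
  finitely_satisfiable p /\ forall phi, p phi \/ p (Not phi).

Record stone (L : language) (C : structure L) (A : set C) (I : Type) : Type :=
  Stone {
  stone_set : set (formula L (I + A));
  stone_complete : complete_type stone_set
}.

Lemma stone_bot (L : language) (C : structure L) (A : set C) (I : Type)
    (p : stone A I) : ~ stone_set p Bot.
Proof.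
case: p => p /= [fp _] pbot.
have [|x /(_ _ erefl)//] := fp [set Bot] _ (finite_set1 _).
by move=> _ ->.
Qed.

Lemma stone_mp (L : language) (C : structure L) (A : set C) (I : Type)
    (p : stone A I) (phi psi : formula L (I + A)) :
  (forall x, sat_over phi x -> sat_over psi x) -> stone_set p phi -> stone_set p psi.
Proof.
case: p => p /= [fp cp] phipsi pphi; have [//|pN] := cp psi.
have [||x qx] := fp [set phi; Not psi].
- by move=> _ [->|->].
- by rewrite finite_setU; split; exact: finite_set1.
- by case: (qx (Not psi) (or_intror erefl)); apply/phipsi/qx; left.
Qed.

Lemma stone_and (L : language) (C : structure L) (A : set C) (I : Type)
    (p : stone A I) (phi psi : formula L (I + A)) :
  stone_set p phi -> stone_set p psi -> stone_set p (And phi psi).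
Proof.
case: p => p /= [fp cp] pphi ppsi; have [//|pN] := cp (And phi psi).
have [||x qx] := fp ([set phi; psi] `|` [set Not (And phi psi)]).
- by move=> _ [[->|->]|->].
- by rewrite !finite_setU; do ?split; exact: finite_set1.
- case: (qx (Not (And phi psi)) (or_intror erefl)) => phiN; apply: phiN.
    by apply: qx; left; left.
  by apply: qx; left; right.
Qed.

HB.instance Definition _ (L : language) (V : Type) :=
  gen_eqMixin (formula L V).
HB.instance Definition _ (L : language) (V : Type) :=
  gen_choiceMixin (formula L V).
HB.instance Definition _ (L : language) (V : Type) :=
  isPointed.Build (formula L V) Bot.

HB.instance Definition _ (L : language) (C : structure L) (A : set C)
    (I : Type) := gen_eqMixin (stone A I).
HB.instance Definition _ (L : language) (C : structure L) (A : set C)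
    (I : Type) := gen_choiceMixin (stone A I).

Definition stone_basic (L : language) (C : structure L) (A : set C)
    (I : Type) (phi : formula L (I + A)) : set (stone A I) :=
  [set p | stone_set p phi].

Lemma stone_basic_cover (L : language) (C : structure L) (A : set C)
    (I : Type) :
  \bigcup_(phi in [set: formula L (I + A)]) stone_basic phi = setT.
Proof.
apply/seteqP; split=> // p _; exists (Not Bot) => //.
by case: ((stone_complete p).2 Bot) => // /stone_bot.
Qed.

Lemma stone_basic_join (L : language) (C : structure L) (A : set C)
    (I : Type) (phi psi : formula L (I + A)) (p : stone A I) :
  [set: formula L (I + A)] phi -> [set: formula L (I + A)] psi ->
  stone_basic phi p -> stone_basic psi p ->
  exists chi, [/\ [set: formula L (I + A)] chi, stone_basic chi p &
    stone_basic chi `<=` stone_basic phi `&` stone_basic psi].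
Proof.
move=> _ _ pphi ppsi; exists (And phi psi); split=> //; first exact: stone_and.
move=> q qand; split; apply: stone_mp qand => x; rewrite /sat_over /=.
  by apply: contra_notP => xN /xN.
by apply: contra_notP => xN _ /xN.
Qed.

HB.instance Definition _ (L : language) (C : structure L) (A : set C)
    (I : Type) :=
  @isBaseTopological.Build (stone A I) (formula L (I + A)) setT
    (@stone_basic L C A I) (@stone_basic_cover L C A I)
    (@stone_basic_join L C A I).

Lemma tp_complete (L : language) (C : structure L) (A : set C) (I : Type)
    (a : I -> C) :
  complete_type [set phi : formula L (I + A) | sat_over phi a].
Proof.
split=> [q qp _|phi]; first by exists a => phi /qp.
exact: EM.
Qed.

Definition tp (L : language) (C : structure L) (A : set C) (I : Type)
    (a : I -> C) : stone A I :=
  Stone (@tp_complete L C A I a).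

Arguments tp {L C} A {I} a.

Definition types_of (L : language) (C : structure L) (A : set C) (I : Type)
    (Y : set (I -> C)) : set (stone A I) :=
  [set tp A a | a in Y].

Arguments types_of {L C} A {I} Y.

(* A strategy for player B maps the moves [(O_0, x_0), .., (O_n, x_n)] of
   player A to the response [W_n]. *)
Definition choquet_strategy (Z : topologicalType) : Type :=
  seq (set Z * Z) -> set Z.

Definition choquet_response (Z : topologicalType) (tau : choquet_strategy Z)
    (O : nat -> set Z) (x : nat -> Z) (n : nat) : set Z :=
  tau (mkseq (fun i => (O i, x i)) n.+1).

Definition choquet_legal (Z : topologicalType) (tau : choquet_strategy Z)
    (O : nat -> set Z) (x : nat -> Z) (n : nat) : Prop :=
  [/\ open (O n),
      O n `<=` (if n is m.+1 then choquet_response tau O x m else setT) &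
      O n (x n)].

Definition choquet_winning (Z : topologicalType) (tau : choquet_strategy Z) :
    Prop :=
  forall (O : nat -> set Z) (x : nat -> Z),
    (forall n, (forall i, (i <= n)%N -> choquet_legal tau O x i) ->
       [/\ open (choquet_response tau O x n),
           choquet_response tau O x n `<=` O n &
           choquet_response tau O x n (x n)]) /\
    ((forall n, choquet_legal tau O x n) ->
       \bigcap_n choquet_response tau O x n !=set0).

Definition strong_choquet (Z : topologicalType) : Prop :=
  exists tau : choquet_strategy Z, choquet_winning tau.

(* The set [types_of M Y] is regarded as a type, which carries the topology
   induced by the Stone space. *)
Definition pseudo_strong_choquet (K : Type) (L : language) (C : structure L)
    (I : Type) (Y : set (I -> C)) : Prop :=
  forall M : set C, small_model K M ->
    strong_choquet (set_type (types_of M Y)).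

Record group_on (S : Type) (H : set S) (mul : S -> S -> S) (one : S)
    (inv : S -> S) : Prop := GroupOn {
  group_one : H one;
  group_mul : forall g h, H g -> H h -> H (mul g h);
  group_inv : forall g, H g -> H (inv g);
  group_mulA : forall g h k, H g -> H h -> H k ->
    mul g (mul h k) = mul (mul g h) k;
  group_mul1g : forall g, H g -> mul one g = g;
  group_mulg1 : forall g, H g -> mul g one = g;
  group_mulVg : forall g, H g -> mul (inv g) g = one;
  group_mulgV : forall g, H g -> mul g (inv g) = one
}.

Record subgroup_of (S : Type) (H : set S) (mul : S -> S -> S) (one : S)
    (inv : S -> S) (G : set S) : Prop := SubgroupOf {
  subgroup_sub : G `<=` H;
  subgroup_one : G one;
  subgroup_mul : forall g h, G g -> G h -> G (mul g h);
  subgroup_inv : forall g, G g -> G (inv g)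
}.

Record action_on (S Z : Type) (H : set S) (mul : S -> S -> S) (one : S)
    (X : set Z) (act : S -> Z -> Z) : Prop := ActionOn {
  action_closed : forall g x, H g -> X x -> X (act g x);
  action_one : forall x, X x -> act one x = x;
  action_mul : forall g h x, H g -> H h -> X x ->
    act (mul g h) x = act g (act h x)
}.

(* The graph of the restriction to [A * B] of a binary operation on tuples. *)
Definition op_graph (I J K S : Type) (A : set (I -> S)) (B : set (J -> S))
    (op : (I -> S) -> (J -> S) -> (K -> S)) : set (I + J + K -> S) :=
  [set tuple_cat (tuple_cat u v) (op u v) | u in A & v in B].

(* The operations [mul], [inv] and [act] are total functions on tuples, but only
   their values on the type-definable sets [H] and [X] are constrained. *)
Record Fsigma_action (K : Type) (L : language) (C : structure L)
    (alpha beta : Type) : Type := FsigmaAction {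
  fsH : set (beta -> C);
  fs_mul : (beta -> C) -> (beta -> C) -> (beta -> C);
  fs_one : beta -> C;
  fs_inv : (beta -> C) -> (beta -> C);
  fsG : set (beta -> C);
  fsV : nat -> set (beta -> C);
  fsX : set (alpha -> C);
  fs_act : (beta -> C) -> (alpha -> C) -> (alpha -> C);
  fsH_group : group_on fsH fs_mul fs_one fs_inv;
  fsH_def : type_definable set0 fsH;
  fs_mul_def : type_definable set0 (op_graph fsH fsH fs_mul);
  fsG_subgroup : subgroup_of fsH fs_mul fs_one fs_inv fsG;
  fsG_invariant : aut_invariant fsG;
  fsG_pseudo_Fsigma : pseudo_Fsigma K fsG;
  fsG_bigcup : fsG = \bigcup_n fsV n;
  fsV_def : forall n, type_definable set0 (fsV n);
  fsV_one : forall n, fsV n fs_one;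
  fsV_inv : forall n, fsV n = [set fs_inv g | g in fsV n];
  fsV_mul : forall n,
    [set fs_mul g h | g in fsV n & h in fsV n] `<=` fsV n.+1;
  fsX_def : type_definable set0 fsX;
  fs_action : action_on fsH fs_mul fs_one fsX fs_act;
  fs_act_def : type_definable set0 (op_graph fsH fsX fs_act)
}.

Definition fsU (K : Type) (L : language) (C : structure L) (alpha beta : Type)
    (F : Fsigma_action K C alpha beta) (n : nat) :
    set ((alpha -> C) * (alpha -> C)) :=
  [set ab | [/\ fsX F ab.1, fsX F ab.2 &
    exists2 g, fsV F n g & fs_act F g ab.1 = ab.2]].

Definition fsE (K : Type) (L : language) (C : structure L) (alpha beta : Type)
    (F : Fsigma_action K C alpha beta) : set ((alpha -> C) * (alpha -> C)) :=
  [set ab | [/\ fsX F ab.1, fsX F ab.2 &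
    exists2 g, fsG F g & fs_act F g ab.1 = ab.2]].

Definition fs_orbit (K : Type) (L : language) (C : structure L)
    (alpha beta : Type) (F : Fsigma_action K C alpha beta) (a : alpha -> C) :
    set (alpha -> C) :=
  [set fs_act F g a | g in fsG F].

Definition quotient (S : Type) (Y : set S) (E : set (S * S)) : set (set S) :=
  [set [set b | Y b /\ E (a, b)] | a in Y].

Definition fs_bounded (K : Type) (L : language) (C : structure L)
    (alpha beta : Type) (F : Fsigma_action K C alpha beta) : Prop :=
  card_lt (quotient (fsX F) (fsE F)) [set: K].

Definition invariant_under (S : Type) (E : set (S * S)) (Y : set S) : Prop :=
  forall a b, E (a, b) -> Y a -> Y b.

Definition right_shifty (K : Type) (L : language) (C : structure L)
    (alpha beta : Type) (F : Fsigma_action K C alpha beta) (a : alpha -> C) :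
    Prop :=
  forall k, exists n, forall g1 g2, fsH F g1 -> fsH F g2 ->
    fsU F k (fs_act F g1 a, fs_act F g2 a) ->
    fsU F n (fs_act F (fs_mul F g1 (fs_inv F g2)) a, a).

Definition left_shifty (K : Type) (L : language) (C : structure L)
    (alpha beta : Type) (F : Fsigma_action K C alpha beta) (a : alpha -> C) :
    Prop :=
  forall k, exists n, forall g1 g2, fsH F g1 -> fsH F g2 ->
    (fsU F k (fs_act F g1 a, fs_act F g2 a) ->
     fsU F n (fs_act F (fs_mul F (fs_inv F g1) g2) a, a)) /\
    (fsU F k (fs_act F (fs_mul F (fs_inv F g1) g2) a, a) ->
     fsU F n (fs_act F g1 a, fs_act F g2 a)).

Definition shifty (K : Type) (L : language) (C : structure L)
    (alpha beta : Type) (F : Fsigma_action K C alpha beta) (a : alpha -> C) :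
    Prop :=
  fsX F a /\ (right_shifty F a \/ left_shifty F a).

Definition strongly_closed_on (K : Type) (L : language) (C : structure L)
    (alpha beta : Type) (F : Fsigma_action K C alpha beta)
    (D : set (alpha -> C)) : Prop :=
  exists n, fsE F `&` (D `*` D) = fsU F n `&` (D `*` D).

(* Main.v *)
(** Write [d(x, y) <= n] for [(x, y)] in [U_n]. Fix a countable subgroup [Gamma]
    of [G] containing elements that move [a] arbitrarily far, and a small model [M]
    containing the coordinates of its elements, so that [Gamma] acts by
    homeomorphisms on the types over [M] of elements of [X].

    A minimal closed [Gamma]-invariant subset [Z] of the closure of the orbit of
    [tp(a/M)] contains the type of some [b] in [G * a]. Indeed, there is an
    ultrafilter of elements [h] of [Gamma] such that [g^-1 * h * a] tends to [Z] for
    all [g] in [Gamma]; if [h1] is a realization of it over [M] and [a], and [h0] a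
    realization over [M], [a] and [h1], then the type of [h0^-1 * h1 * a] is in [Z].
    As [h0] and [h1] have the same type over [M] and [a], boundedness yields that
    [h0 * a] is equivalent to [h1 * a] and [h0^-1 * a] to [h1^-1 * a], whence
    [h0^-1 * h1 * a] is in [G * a] by shiftiness.

    By minimality and compactness, for any neighbourhood [W] of [tp(b/M)], finitely
    many translates of [W] cover [Gamma * b]. As [Gamma] moves [a] arbitrarily far, so
    do the elements [g] of [Gamma] with [tp(g * b/M)] in [W]. Hence any point of
    the orbit of [tp(b/M)] can be moved slightly so as to be far from finitely many
    given points, and the strategy of player B, followed along a binary tree of
    positions, produces continuum many pairwise inequivalent elements. *)

Require Import Defs.
From mathcomp Require Import all_boot all_classical topology.
From Stdlib Require List.

Set Implicit Arguments.
Unset Strict Implicit.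
Unset Printing Implicit Defensive.

Local Open Scope classical_set_scope.
Local Open Scope card_scope.

(** * Cardinal arithmetic *)

(** Zorn's lemma for relations with values in [Prop]. Only nonempty chains must be bounded by hand;
    [t0] serves for the empty one. *)
Lemma zorn_preorder (T : Type) (t0 : T) (R : T -> T -> Prop) :
  (forall t, R t t) -> (forall r s t, R r s -> R s t -> R r t) ->
  (forall A : set T, A !=set0 -> total_on A R ->
     exists t, forall s, A s -> R s t) ->
  exists t, forall s, R t s -> R s t.
Proof.
move=> Rxx Rtr ub; pose R' s t := `[< R s t >].
have [|r s t||t tmax] := @ZL_preorder T t0 R'.
- by move=> t; apply/asboolP.
- by move=> /asboolP rs /asboolP st; apply/asboolP/(Rtr _ s).
- move=> A Atot; have [A0|A0] := pselect (A !=set0); last first.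
    by exists t0 => s As; case: A0; exists s.
  have [|t tub] := ub A A0.
    by move=> s t As At; have [/asboolP|/asboolP] := Atot _ _ As At; [left|right].
  by exists t => s As; apply/asboolP/tub.
by exists t => s Rts; apply/asboolP/tmax/asboolP.
Qed.

(** Comparing types directly, with sets entering through their subtypes, makes sums, products and
    sequences easy to handle. *)
Definition cle (S T : Type) : Prop := exists f : S -> T, injective f.

Lemma card_le_sig (S T : Type) (A : set S) (B : set T) : A #<= B <-> cle A B.
Proof.
split=> [/card_leP/injfunPex[f _ finj]|[f finj]].
  by exists f => s s'; apply: finj; rewrite in_setT.
by apply/card_leP/injfunPex; exists f => // s s' _ _; exact: finj.
Qed.

Lemma cle_trans (S T U : Type) : cle S T -> cle T U -> cle S U.
Proof. by move=> [f fi] [g gi]; exists (g \o f); exact: inj_comp. Qed.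

(** A maximal partial matching, given as a set of pairs, exhausts one of the two types, since
    otherwise an unmatched pair could be added. The equivalence in [pinj] expresses functionality
    and injectivity at once. *)
Lemma cle_total (S T : Type) : cle S T \/ cle T S.
Proof.
pose pinj (P : set (S * T)) := forall p q, P p -> P q -> p.1 = q.1 <-> p.2 = q.2.
have [F FP Ftot|P [Ppinj Pmax]] := @Zorn_bigcup _ pinj.
  move=> p q [X FX Xp] [Y FY Yq].
  have [XY|YX] := Ftot _ _ FX FY.
    by apply: (FP _ FY) => //; exact: XY.
  by apply: (FP _ FX) => //; exact: YX.
have [Sdom|] := pselect (forall s, exists t, P (s, t)).
  have /choice[f fP] := Sdom; left; exists f => s s' fss'.
  exact: (Ppinj _ _ (fP s) (fP s')).2.
move=> /existsNP[s /forallNP sP].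
have [Tdom|] := pselect (forall t, exists s, P (s, t)).
  have /choice[f fP] := Tdom; right; exists f => t t' ftt'.
  exact: (Ppinj _ _ (fP t) (fP t')).1.
move=> /existsNP[t /forallNP tP]; exfalso.
apply: (Pmax ((s, t) |` P)).
  split; first by move=> p Pp; right.
  by move=> /(_ (s, t) (or_introl erefl)); exact: sP.
move=> [x y] [x' y'] [[-> ->]|Pp] [[-> ->]|Pq] //=.
- split=> e; first by case: (sP y'); rewrite e.
  by case: (tP x'); rewrite e.
- split=> e; first by case: (sP y); rewrite -e.
  by case: (tP x); rewrite -e.
- exact: (Ppinj (x, y) (x', y')).
Qed.

Lemma cle_sum (S S' T T' : Type) : cle S T -> cle S' T' -> cle (S + S') (T + T').
Proof.
move=> [f fi] [g gi].
exists (fun v => match v with inl s => inl (f s) | inr s => inr (g s) end).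
by move=> [s|s] [s'|s'] //= [] => [/fi|/gi] ->.
Qed.

Lemma cle_prod (S S' T T' : Type) : cle S T -> cle S' T' -> cle (S * S') (T * T').
Proof.
move=> [f fi] [g gi]; exists (fun v => (f v.1, g v.2)).
by move=> [s s'] [t t'] [/fi/= -> /gi/= ->].
Qed.

Lemma cle_seq (S T : Type) : cle S T -> cle (seq S) (seq T).
Proof. by move=> [f fi]; exists (map f); exact: inj_map. Qed.

Lemma cle_countable (S : countType) : cle S nat.
Proof. by exists pickle; exact: pcan_inj pickleK. Qed.

Lemma cle_sig (S : Type) (A : set S) : cle A S.
Proof. by exists val; exact: val_inj. Qed.

Lemma cle_surj (S T : Type) (f : S -> T) : (forall t, exists s, f s = t) -> cle T S.
Proof.
by move=> /choice[g gK]; exists g => t t' e; rewrite -(gK t) -(gK t') e.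
Qed.

(* An injection of [A * A] into [A] with [A] maximal: if the complement of [A]
   had a part [B] equipotent to [A], the injection would extend to the square of
   the union of [A] and [B], the three new rectangles being sent into [B]. So the
   complement embeds in [A], and so does the whole type. *)
Record square_inj (S : Type) := SquareInj {
  sq_dom : set S;
  sq_fun : S * S -> S;
  sq_closed : forall p, sq_dom p.1 -> sq_dom p.2 -> sq_dom (sq_fun p);
  sq_injective : forall p q, sq_dom p.1 -> sq_dom p.2 -> sq_dom q.1 -> sq_dom q.2 ->
    sq_fun p = sq_fun q -> p = q;
  sq_infinite : cle nat sq_dom
}.

Definition square_le (S : Type) (P Q : square_inj S) : Prop :=
  sq_dom P `<=` sq_dom Q /\
  forall p, sq_dom P p.1 -> sq_dom P p.2 -> sq_fun P p = sq_fun Q p.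

Lemma square_inj_nat (S : Type) : cle nat S -> inhabited (square_inj S).
Proof.
move=> [i ii]; pose r : S -> nat := 'pinv_(fun=> 0) [set: nat] i.
have iK : cancel i r by move=> n; rewrite /r pinvKV // ?inE // => ? ? _ _; exact: ii.
constructor; apply: (@SquareInj _ (range i) (fun p => i (pickle (r p.1, r p.2)))).
- by move=> p _ _; exists (pickle (r p.1, r p.2)).
- move=> [? ?] [? ?] /= [a _ <-] [b _ <-] [c _ <-] [d _ <-] /ii.
  by rewrite !iK => /(pcan_inj pickleK)[-> ->].
- exists (fun n => SigSub (mem_set (imageP i (I : setT n)))) => n m.
  by move=> /(congr1 val)/ii.
Qed.

(** The images of the three summands are told apart by their first coordinates [i 0], [i 1] and
    [i 2]. *)
Lemma square_sum (S : Type) (A : set S) : cle nat A -> cle (A * A) A -> 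
  cle (A + A * A + A * A) A.
Proof.
move=> [i ii] [f fi].
exists (fun v => f (match v with 
  | inl (inl a) => (i 0, f (a, a))
  | inl (inr p) => (i 1, f p)
  | inr p => (i 2, f p) end)).
move=> [[a|p]|p] [[b|q]|q] /fi e; have /= e1 := congr1 fst e;
  have /= e2 := congr1 snd e; try by move/ii: e1.
- by case/fi: e2 => ->.
- by move/fi: e2 => ->.
- by move/fi: e2 => ->.
Qed.

Lemma cle_sub (S : Type) (A B : set S) : A `<=` B -> cle A B.
Proof.
move=> AB; exists (fun s => SigSub (mem_set (AB _ (set_mem (valP s))))).
by move=> s s' /(congr1 val)/= /val_inj.
Qed.

Lemma sig_inj_fun (S T : Type) (A : set S) (B : set T) (t0 : T) : cle A B ->
  exists f : S -> T, (forall s, A s -> B (f s)) /\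
    forall s s', A s -> A s' -> f s = f s' -> s = s'.
Proof.
move=> [f fi].
exists (fun s => match pselect (A s) with
  | left As => val (f (SigSub (mem_set As))) | right _ => t0 end).
split=> [s As|s s' As As'].
  by case: pselect => // Hs; exact/set_mem/valP.
case: pselect => // Hs; case: pselect => // Hs' /val_inj/fi.
by move/(congr1 val).
Qed.

Lemma cle_square (S : Type) : cle nat S -> cle (S * S) S.
Proof.
move=> natS; have [P0] := square_inj_nat natS.
have [||F [P FP] Ftot|P Pmax] := @zorn_preorder _ P0 (@square_le S).
- by move=> P; split.
- move=> P Q R [PQ ePQ] [QR eQR]; split; first exact: subset_trans QR.
  by move=> p p1 p2; rewrite ePQ // eQR //; exact: PQ.
- pose A := \bigcup_(Q in F) sq_dom Q.
  have inF p : A p.1 -> A p.2 -> exists Q, [/\ F Q, sq_dom Q p.1 & sq_dom Q p.2].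
    move=> [Q FQ Qp] [R FR Rp]; have [[QR _]|[RQ _]] := Ftot _ _ FQ FR.
      by exists R; split=> //; exact: QR.
    by exists Q; split=> //; exact: RQ.
  have inF2 p q : A p.1 -> A p.2 -> A q.1 -> A q.2 ->
      exists Q, [/\ F Q, sq_dom Q p.1, sq_dom Q p.2, sq_dom Q q.1 & sq_dom Q q.2].
    move=> Ap1 Ap2 Aq1 Aq2; have [Q [FQ Q1 Q2]] := inF p Ap1 Ap2.
    have [R [FR R1 R2]] := inF q Aq1 Aq2.
    have [[QR _]|[RQ _]] := Ftot _ _ FQ FR.
      by exists R; split=> //; exact: QR.
    by exists Q; split=> //; exact: RQ.
  (* The functions of the chain agree wherever they are defined; outside the square of [A] the value
     [p.1] is arbitrary. *)
  have /choice[g gP] : forall p, exists s, forall Q, F Q -> sq_dom Q p.1 ->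
      sq_dom Q p.2 -> s = sq_fun Q p.
    move=> p; have [[A1 A2]|nA] := pselect (A p.1 /\ A p.2).
      have [Q [FQ Q1 Q2]] := inF p A1 A2; exists (sq_fun Q p) => R FR R1 R2.
      have [[_ QR]|[_ RQ]] := Ftot _ _ FQ FR; first exact: QR.
      by rewrite RQ.
    exists p.1 => Q FQ Q1 Q2; exfalso; apply: nA.
    by split; exists Q.
  have gA p : A p.1 -> A p.2 -> A (g p).
    move=> A1 A2; have [Q [FQ Q1 Q2]] := inF p A1 A2.
    by exists Q => //; rewrite (gP p Q) //; exact: sq_closed.
  have gi p q : A p.1 -> A p.2 -> A q.1 -> A q.2 -> g p = g q -> p = q.
    move=> p1 p2 q1 q2; have [Q [FQ Qp1 Qp2 Qq1 Qq2]] := inF2 p q p1 p2 q1 q2.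
    by rewrite (gP p Q) // (gP q Q) //; exact: sq_injective.
  have Ainf : cle nat A.
    by apply: cle_trans (sq_infinite P) _; apply: cle_sub => s Ps; exists P.
  exists (SquareInj gA gi Ainf) => Q FQ; split=> [s Qs|p p1 p2] /=.
    by exists Q.
  by rewrite (gP p Q).
have AA : cle (sq_dom P * sq_dom P)%type (sq_dom P).
  exists (fun p => SigSub (mem_set (sq_closed (p := (val p.1, val p.2))
    (set_mem (valP p.1)) (set_mem (valP p.2))))).
  move=> [p1 p2] [q1 q2] /(congr1 val)/= e.
  have [] := @sq_injective _ P (val p1, val p2) (val q1, val q2)
    (set_mem (valP p1)) (set_mem (valP p2)) (set_mem (valP q1))
    (set_mem (valP q2)) e.
  by move=> /val_inj -> /val_inj ->.
have sumA := square_sum (sq_infinite P) AA.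
have [BA|AB] := cle_total (~` sq_dom P) (sq_dom P).
  have SA : cle S (sq_dom P).
    apply: cle_trans sumA.
    have [f fi] := BA; have [i ii] := sq_infinite P.
    exists (fun s => match pselect (sq_dom P s) with
      | left As => inl (inl (SigSub (mem_set As)))
      | right nAs => inr (i 0, f (SigSub (mem_set (nAs : (~` sq_dom P) s)))) end).
    move=> s s'; case: pselect => As; case: pselect => As' //.
      by move=> [].
    by move=> [] /fi/(congr1 val).
  exact: cle_trans (cle_prod SA SA) (cle_trans AA (cle_sig _)).
exfalso.
have [s0 _] : exists s : S, True by case: natS => i _; exists (i 0).
have [h [hA hi]] := sig_inj_fun s0 AB.
pose B := h @` sq_dom P; pose A := sq_dom P `|` B.
have BnA s : B s -> ~ sq_dom P s by move=> [t /hA nt <-].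
have BA : cle B (sq_dom P).
  have /choice[k kP] : forall s : B, exists t : sq_dom P, h (val t) = val s.
    move=> s; have [t At ts] := set_mem (valP s).
    by exists (SigSub (mem_set At)).
  by exists k => s s' e; apply: val_inj; rewrite -!kP e.
have sqB : cle (A * A)%type (sq_dom P).
  have AsumA : cle A (sq_dom P + sq_dom P).
    have [f fi] := BA.
    exists (fun s => match pselect (sq_dom P (val s)) with
      | left As => inl (SigSub (mem_set As))
      | right nAs => inr (f (SigSub (mem_set
           (match set_mem (valP s) with or_introl As => False_ind _ (nAs As) | or_intror Bs => Bs end)))) end).
    move=> s s'; case: pselect => As; case: pselect => As' //.
      by move=> []/val_inj.
    by move=> [] /fi/(congr1 val)/= /val_inj.
  have [i ii] := sq_infinite P.
  have sA : cle (sq_dom P + sq_dom P) (sq_dom P).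
    apply: cle_trans sumA.
    exists (fun v => match v with inl s => inl (inl s) | inr s => inr (i 0, s) end).
    by move=> [s|s] [s'|s'] [] // ->.
  have AAA := cle_trans AsumA sA.
  exact: cle_trans (cle_prod AAA AAA) AA.
have sqAB : cle (A `*` A) (sq_dom P).
  apply: cle_trans sqB.
  have m1 (p : set_type (A `*` A)) : (val p).1 \in A.
    exact/mem_set/(set_mem (valP p)).1.
  have m2 (p : set_type (A `*` A)) : (val p).2 \in A.
    exact/mem_set/(set_mem (valP p)).2.
  exists (fun p => (SigSub (m1 p) : A, SigSub (m2 p) : A)).
  move=> p q [e1 e2]; apply: val_inj.
  by rewrite (surjective_pairing (val p)) (surjective_pairing (val q)) e1 e2.
have [f [fA fi]] := sig_inj_fun s0 sqAB.
(* Off the old square the values lie in [B], which is disjoint from [sq_dom P], so the two cases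
   cannot collide. *)
pose g p := if pselect (sq_dom P p.1 /\ sq_dom P p.2) then sq_fun P p else h (f p).
have gA p : A p.1 -> A p.2 -> A (g p).
  move=> A1 A2; rewrite /g; case: pselect => [[? ?]|?]; first by left; exact: sq_closed.
  by right; exists (f p) => //; exact: fA.
have gi p q : A p.1 -> A p.2 -> A q.1 -> A q.2 -> g p = g q -> p = q.
  move=> p1 p2 q1 q2; rewrite /g.
  have fp : sq_dom P (f p) by exact: fA.
  have fq : sq_dom P (f q) by exact: fA.
  case: pselect => [[? ?]|?]; case: pselect => [[? ?]|?] /=.
  - exact: sq_injective.
  - by move=> e; case: (hA _ fq); rewrite -e; exact: sq_closed.
  - by move=> e; case: (hA _ fp); rewrite e; exact: sq_closed.
  - by move=> /(hi _ _ fp fq); exact: fi.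
have Ainf : cle nat A.
  by apply: cle_trans (sq_infinite P) _; apply: cle_sub => s Ps; left.
(* Maximality would place the nonempty set [B] inside [sq_dom P], although it was taken in the
   complement. *)
have [|AP _] := Pmax (SquareInj gA gi Ainf).
  split=> [s Ps|p p1 p2] /=; first by left.
  by rewrite /g; case: pselect => // n; case: n.
have [i _] := sq_infinite P.
have Pi0 := set_mem (valP (i 0)).
by case: (hA _ Pi0); apply: AP; right; exists (val (i 0)).
Qed.

Lemma cle_sum_square (S T U : Type) : cle nat U -> cle S U -> cle T U -> cle (S + T) U.
Proof.
move=> [i ii] SU TU; apply: cle_trans (cle_sum SU TU) _.
apply: cle_trans (cle_square (ex_intro _ i ii)).
exists (fun v : U + U => match v with inl u => (i 0, u) | inr u => (i 1, u) end).
by move=> [u|u] [v|v] /= e; have /= e1 := congr1 fst e;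
  have /= e2 := congr1 snd e; rewrite ?e2 //; move/ii: e1.
Qed.

Lemma cle_prod_square (S T U : Type) : cle nat U -> cle S U -> cle T U -> cle (S * T) U.
Proof. by move=> iU SU TU; apply: cle_trans (cle_prod SU TU) (cle_square iU). Qed.

Lemma cle_seq_infinite (S : Type) : cle nat S -> cle (seq S) S.
Proof.
move=> natS; have [f fi] := cle_square natS.
apply: cle_trans (_ : cle (nat * S)%type S); last first.
  by apply: cle_prod_square => //; exists id.
have [i _] := natS.
(* The entries are folded into a single element by repeated pairing; the length makes the result
   decodable. *)
exists (fun s => (size s, foldr (fun x y => f (x, y)) (i 0) s)).
elim=> [|x s IH] [|y t] //= [est /fi[-> e]].
by congr (_ :: _); apply: IH; rewrite est e.
Qed.

Lemma cle_setT (S : Type) : cle S [set: S].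
Proof. by exists (fun s => SigSub (mem_set (I : setT s))) => s s' /(congr1 val). Qed.

(** By comparability of cardinals, failing to contain a copy of [K] already implies embedding in
    [K]. *)
Lemma smallE (K S : Type) (A : set S) : small K A <-> ~ cle K A.
Proof.
have KE : ([set: K] #<= A) <-> cle K A.
  rewrite card_le_sig; split; apply: cle_trans.
    exact: cle_setT.
  exact: cle_sig.
split=> [[_ nK]|nK]; first by move/KE.
split; last by move/KE.
have [//|AK] := cle_total K A.
exact/card_le_sig/(cle_trans AK)/cle_setT.
Qed.

Lemma small_typeE (K S : Type) : small K [set: S] <-> ~ cle K S.
Proof.
rewrite smallE; split; apply: contra_not => KS; apply: (cle_trans KS).
  exact: cle_setT.
exact: cle_sig.
Qed.

Section SmallTypes.
Variable K : Type.
Hypothesis Kbig : ~ cle K nat.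

Definition smT (S : Type) : Prop := ~ cle K S.

Lemma smT_le (S T : Type) : cle S T -> smT T -> smT S.
Proof. by move=> ST nT /cle_trans-/(_ _ ST). Qed.

Lemma smT_countable (S : countType) : smT S.
Proof. exact: smT_le (cle_countable S) Kbig. Qed.

(** Comparability provides the largest of [S], [T] and [nat], which absorbs sums and products by
    [cle_square]. *)
Lemma smT_max (S T : Type) : smT S -> smT T ->
  exists U, [/\ smT U, cle nat U, cle S U & cle T U].
Proof.
move=> sS sT.
have [V [sV nV SV]] : exists V, [/\ smT V, cle nat V & cle S V].
  have [?|?] := cle_total S nat; [exists nat|exists S]; split=> //; by exists id.
have [TV|VT] := cle_total T V; first by exists V.
by exists T; split=> //; [exact: cle_trans VT|exact: cle_trans VT|exists id].
Qed.

Lemma smT_sum (S T : Type) : smT S -> smT T -> smT (S + T).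
Proof.
by move=> sS sT; have [U [sU nU SU TU]] := smT_max sS sT;
  apply: smT_le sU; exact: cle_sum_square.
Qed.

Lemma smT_prod (S T : Type) : smT S -> smT T -> smT (S * T).
Proof.
by move=> sS sT; have [U [sU nU SU TU]] := smT_max sS sT;
  apply: smT_le sU; exact: cle_prod_square.
Qed.

Lemma smT_seq (S : Type) : smT S -> smT (seq S).
Proof.
move=> sS; have [U [sU nU SU _]] := smT_max sS sS.
exact: smT_le (cle_trans (cle_seq SU) (cle_seq_infinite nU)) sU.
Qed.

Lemma smT_range (S T : Type) (f : S -> T) : smT S -> smT (range f).
Proof.
apply: smT_le.
apply: (@cle_surj _ _ (fun s => SigSub (mem_set (imageP f (I : setT s))))) => t.
by have [s _ st] := set_mem (valP t); exists s; apply: val_inj.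
Qed.

End SmallTypes.

(** * Syntax *)

Fixpoint rename_term (L : language) (V W : Type) (f : V -> W) (t : term L V) :
    term L W :=
  match t with
  | Var v => Var L (f v)
  | App g args => App (fun i => rename_term f (args i))
  end.

Fixpoint rename (L : language) (V W : Type) (f : V -> W) (phi : formula L V) :
    formula L W :=
  match phi with
  | Bot => Bot
  | Eq t u => Eq (rename_term f t) (rename_term f u)
  | Rel r args => Rel (fun i => rename_term f (args i))
  | Imp phi1 phi2 => Imp (rename f phi1) (rename f phi2)
  | All psi => All (rename (omap f) psi)
  end.

Definition Ex (L : language) (V : Type) (phi : formula L (option V)) :
    formula L V := Not (All (Not phi)).

Definition ands (L : language) (V : Type) (l : seq (formula L V)) :
    formula L V := foldr (@And L V) (Not Bot) l.

Definition ext_env (V S : Type) (s : V -> S) (c : S) : option V -> S :=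
  fun v => if v is Some w then s w else c.

Definition upd (V S : Type) (s : V -> S) (v : V) (c : S) : V -> S :=
  fun w => if `[< w = v >] then c else s w.

Section Semantics.
Variables (L : language) (C : structure L).

Lemma eval_rename (V W : Type) (f : V -> W) (s : W -> C) (t : term L V) :
  Defs.eval s (rename_term f t) = Defs.eval (s \o f) t.
Proof.
elim: t => [//|g args IH] /=; congr fun_interp.
by apply: funext => i; exact: IH.
Qed.

Lemma sat_rename (V W : Type) (f : V -> W) (s : W -> C) (phi : formula L V) :
  sat (rename f phi) s = sat phi (s \o f).
Proof.
elim: phi W f s => [//|V' t u|V' r args|V' phi1 IH1 phi2 IH2|V' psi IH] W f s /=.
- by rewrite !eval_rename.
- by congr rel_interp; apply: funext => i; exact: eval_rename.
- by rewrite IH1 IH2.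
- apply/eq_forall => c; rewrite IH; congr sat.
  by apply: funext => -[].
Qed.

Lemma sat_Not (V : Type) (phi : formula L V) (s : V -> C) :
  sat (Not phi) s = ~ sat phi s.
Proof. by []. Qed.

Lemma sat_And (V : Type) (phi psi : formula L V) (s : V -> C) :
  sat (And phi psi) s = (sat phi s /\ sat psi s).
Proof.
apply/propext => /=; split=> [nn|[? ?]]; last by apply.
by split; apply: contrapT => n; apply: nn => h // h'.
Qed.

Lemma sat_Ex (V : Type) (phi : formula L (option V)) (s : V -> C) :
  sat (Ex phi) s = exists c, sat phi (ext_env s c).
Proof.
apply/propext => /=; split=> [nn|[c hc] n]; last exact: (n c).
by apply: contrapT => /forallNP n; apply: nn => c; exact: n.
Qed.

Lemma sat_ands (V : Type) (l : seq (formula L V)) (s : V -> C) :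
  sat (ands l) s <-> forall phi, phi \in l -> sat phi s.
Proof.
elim: l => [|psi l IH]; first by split=> // _ [].
have -> : ands (psi :: l) = And psi (ands l) by [].
rewrite sat_And; split.
  by move=> [spsi /IH sl] phi; rewrite inE => /predU1P[->|/sl].
move=> h; split; first by apply: h; rewrite mem_head.
by apply/IH => phi lphi; apply: h; rewrite inE lphi orbT.
Qed.

(** Membership is [List.In] because [V] is an arbitrary type, without decidable equality. *)
Lemma eval_support (V : Type) (t : term L V) : exists l : seq V,
  forall s s' : V -> C, (forall v, List.In v l -> s v = s' v) ->
    Defs.eval s t = Defs.eval s' t.
Proof.
elim: t => [v|g args IH].
  by exists [:: v] => s s' e /=; apply: e; left.
have /choice[l lP] := IH.
exists (flatten [seq l i | i <- enum 'I_(fun_arity g)]) => s s' e /=.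
congr fun_interp; apply: funext => i; apply: lP => v vl; apply: e.
have : i \in enum 'I_(fun_arity g) by rewrite mem_enum.
elim: (enum _) => [//|j r IHr]; rewrite inE => /predU1P[<-|ir] /=.
  by apply: List.in_or_app; left.
by apply: List.in_or_app; right; exact: IHr.
Qed.

Lemma sat_support (V : Type) (phi : formula L V) : exists l : seq V,
  forall s s' : V -> C, (forall v, List.In v l -> s v = s' v) ->
    sat phi s = sat phi s'.
Proof.
elim: phi => [V'|V' t u|V' r args|V' phi1 [l1 IH1] phi2 [l2 IH2]|V' psi [l IH]].
- by exists nil.
- have [l1 h1] := eval_support t; have [l2 h2] := eval_support u.
  exists (l1 ++ l2) => s s' e /=; congr (_ = _).
    by apply: h1 => v vl; apply: e; apply: List.in_or_app; left.
  by apply: h2 => v vl; apply: e; apply: List.in_or_app; right.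
- have /choice[l lP] := fun i => eval_support (args i).
  exists (flatten [seq l i | i <- enum 'I_(rel_arity r)]) => s s' e /=.
  congr rel_interp; apply: funext => i; apply: lP => v vl; apply: e.
  have : i \in enum 'I_(rel_arity r) by rewrite mem_enum.
  elim: (enum _) => [//|j q IHq]; rewrite inE => /predU1P[<-|iq] /=.
    by apply: List.in_or_app; left.
  by apply: List.in_or_app; right; exact: IHq.
- exists (l1 ++ l2) => s s' e /=; rewrite (IH1 s s'); last first.
    by move=> v vl; apply: e; apply: List.in_or_app; left.
  rewrite (IH2 s s') // => v vl.
  by apply: e; apply: List.in_or_app; right.
- exists (pmap id l) => s s' e /=; apply/eq_forall => c; apply: IH => -[v|//] vl.
  apply: e; elim: l vl => [//|[w|] l IHl] /= [] //.
  + by move=> [->]; left.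
  + by right; exact: IHl.
Qed.

Lemma sat_support_left (I J : Type) (phi : formula L (I + J)) :
  exists l : seq I, forall (x x' : I -> C) (y : J -> C),
    (forall i, List.In i l -> x i = x' i) ->
    sat phi (tuple_cat x y) = sat phi (tuple_cat x' y).
Proof.
have [l lP] := sat_support phi.
exists (pmap (fun v => if v is inl i then Some i else None) l) => x x' y e.
apply: lP => -[i|//] vl /=; apply: e.
elim: l vl => [//|[w|w] l IHl] /= [] //.
- by move=> [->]; left.
- by right; exact: IHl.
Qed.

Lemma upd_same (V S : Type) (s : V -> S) v c : upd s v c v = c.
Proof. by rewrite /upd; case: asboolP. Qed.

Lemma upd_other (V S : Type) (s : V -> S) v c w : w <> v -> upd s v c w = s w.
Proof. by rewrite /upd; case: asboolP. Qed.

(** Renaming along [free_var v] turns [v] into the variable bound by the next quantifier. *)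
Definition free_var (V : Type) (v w : V) : option V :=
  if `[< w = v >] then None else Some w.

Lemma ext_env_free_var (V : Type) (s : V -> C) v c :
  ext_env s c \o free_var v = upd s v c.
Proof. by apply: funext => w; rewrite /= /free_var /upd; case: asboolP. Qed.

Lemma upd_inl (I J S : Type) (x : I -> S) (y : J -> S) i c :
  upd (tuple_cat x y) (inl i) c = tuple_cat (upd x i c) y.
Proof.
apply: funext => -[j|j]; last by rewrite upd_other.
have [->|ji] := pselect (j = i); first by rewrite upd_same /= upd_same.
by rewrite upd_other /= ?upd_other // => -[].
Qed.

(** Quantification over a possibly infinite tuple stays first-order because only finitely many of
    its coordinates occur in [phi]; they are bound one at a time. *)
Lemma quantify_left (I J : Type) (phi : formula L (I + J)) :
  exists psi : formula L J, forall y : J -> C,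
    sat psi y <-> exists x : I -> C, sat phi (tuple_cat x y).
Proof.
have [l] := sat_support_left phi; elim: l phi => [|i l IH] phi lP.
  (* No coordinate in [I] matters any more: all are identified with one bound variable, and as the
     carrier is nonempty, [All] then has the force of an existential quantifier. *)
  exists (All (rename (fun v => if v is inr j then Some j else None) phi)) => y.
  have [c0] := carrier_nonempty C.
  have E c : sat (rename (fun v => if v is inr j then Some j else None) phi)
      (ext_env y c) = sat phi (tuple_cat (fun=> c) y).
    by rewrite sat_rename; congr sat; apply: funext => -[].
  split=> /= [h|[x hx] c]; first by exists (fun=> c0); rewrite -E; exact: h.
  by rewrite -/(ext_env y c) E (lP _ x).
have E (x : I -> C) y : sat (Ex (rename (free_var (inl i)) phi)) (tuple_cat x y) =
    exists c, sat phi (tuple_cat (upd x i c) y).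
  rewrite sat_Ex; apply/eq_exists => c.
  by rewrite sat_rename ext_env_free_var upd_inl.
have [x x' y e|psi psiP] := IH (Ex (rename (free_var (inl i)) phi)).
  rewrite !E; apply/eq_exists => c; apply: lP => j /=.
  have [-> _|ji [/esym//|jl]] := pselect (j = i); first by rewrite !upd_same.
  by rewrite !upd_other //; exact: e.
exists psi => y; rewrite psiP; split=> [[x]|[x hx]].
  by rewrite E => -[c hc]; exists (upd x i c).
exists x; rewrite E; exists (x i); suff -> : upd x i (x i) = x by [].
by apply: funext => j; rewrite /upd; case: asboolP => [->|].
Qed.

(* Iterated Tarski-Vaught: witnesses for a finite block of variables are found
   one at a time. *)
Lemma tuple_witness (M : set C) (I D : Type) (d : D -> C)
    (phi : formula L (I + D)) (x0 : I -> C) :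
  M !=set0 ->
  (forall (V : Type) (chi : formula L (option V)) (s : V -> C),
     (forall v, M (s v)) -> (exists c, sat chi (ext_env s c)) ->
     exists2 c, M c & sat chi (ext_env s c)) ->
  (forall v, M (d v)) -> sat phi (tuple_cat x0 d) ->
  exists2 x : I -> C, (forall i, M (x i)) & sat phi (tuple_cat x d).
Proof.
move=> [m Mm] TV dM; have [l] := sat_support_left phi; elim: l phi => [|i l IH] phi lP sx0.
  by exists (fun=> m) => //; rewrite (lP _ x0).
have E (x : I -> C) y : sat (Ex (rename (free_var (inl i)) phi)) (tuple_cat x y) =
    exists c, sat phi (tuple_cat (upd x i c) y).
  rewrite sat_Ex; apply/eq_exists => c.
  by rewrite sat_rename ext_env_free_var upd_inl.
have [x x' y e||x xM] := IH (Ex (rename (free_var (inl i)) phi)).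
- rewrite !E; apply/eq_exists => c; apply: lP => j /=.
  have [-> _|ji [/esym//|jl]] := pselect (j = i); first by rewrite !upd_same.
  by rewrite !upd_other //; exact: e.
- rewrite E; exists (x0 i); suff -> : upd x0 i (x0 i) = x0 by [].
  by apply: funext => j; rewrite /upd; case: asboolP => [->|].
rewrite sat_Ex => /TV[[j|j]|c Mc]; [exact: xM|exact: dM|].
rewrite sat_rename ext_env_free_var upd_inl => h.
exists (upd x i c) => // j; rewrite /upd; by case: asboolP => _.
Qed.

End Semantics.

(** * Saturation and homogeneity *)

(** Parameters form a tuple indexed by a type instead of a set, so that they can be concatenated and
    reindexed by renaming. *)
Definition fin_sat (L : language) (C : structure L) (I D : Type) (d : D -> C)
    (p : set (formula L (I + D))) : Prop :=
  forall l : seq (formula L (I + D)), (forall phi, phi \in l -> p phi) ->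
    exists x : I -> C, sat (ands l) (tuple_cat x d).

Lemma ands_cat (L : language) (C : structure L) (V : Type)
    (l l' : seq (formula L V)) (s : V -> C) :
  sat (ands (l ++ l')) s <-> sat (ands l) s /\ sat (ands l') s.
Proof.
rewrite !sat_ands; split=> [h|[h h'] phi].
  by split=> phi lphi; apply: h; rewrite mem_cat lphi ?orbT.
by rewrite mem_cat => /orP[/h|/h'].
Qed.

Section Monster.
Variables (K : Type) (L : language) (C : structure L).
Hypothesis K_big : small K [set: set (nat + fun_sym L + rel_sym L)].
Hypothesis C_sat : saturated K C.
Hypothesis C_hom : homogeneous K C.

Lemma monster_infinite : ~ cle K nat.
Proof.
move/small_typeE: K_big; apply: contra_not => /cle_trans; apply.
exists (fun n => [set inl (inl n)]) => n m e.
have : [set inl (inl m)] (inl (inl n) : nat + fun_sym L + rel_sym L) by rewrite -e.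
by move=> [].
Qed.

Lemma monster_language : smT K (nat + fun_sym L + rel_sym L).
Proof.
move/small_typeE: K_big; apply: contra_not => /cle_trans; apply.
by exists (fun n => [set n]) => n m e; have : [set m] n by rewrite -e.
Qed.

(** Renaming each parameter variable to the element it denotes turns the tuple [d] into the
    parameter set [range d]. *)
Lemma saturated_one (D : Type) (d : D -> C) (p : set (formula L (unit + D))) :
  smT K D -> fin_sat d p ->
  exists x, forall phi, p phi -> sat phi (tuple_cat x d).
Proof.
move=> sD fp.
pose r (v : unit + D) : unit + range d :=
  match v with inl u => inl u | inr e => inr (SigSub (mem_set (imageP d (Logic.I : setT e)))) end.
have rE (x : unit -> C) : tuple_cat x (fun a : range d => val a) \o r = tuple_cat x d.
  by apply: funext => -[].
have [|q qp /finite_seqP[l ql]|x xP] := C_sat (A := range d) (p := [set rename r phi | phi in p]).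
- by apply/smallE; exact: smT_range sD.
- have : exists l' : seq (formula L (unit + D)), (forall psi, psi \in l' -> p psi) /\
      forall phi, phi \in l -> exists2 psi, psi \in l' & rename r psi = phi.
    have : forall phi, phi \in l -> exists2 psi, p psi & rename r psi = phi.
      by move=> phi lphi; apply: qp; rewrite ql.
    elim: l {q qp ql} => [|phi l IH] h; first by exists nil.
    have [phi' phi'l|l' [l'p ll']] := IH; first by apply: h; rewrite inE phi'l orbT.
    have [psi ppsi psiE] := h phi (mem_head _ _).
    exists (psi :: l'); split=> [chi|chi]; rewrite inE => /predU1P[->//|].
      exact: l'p.
      by exists psi; rewrite ?mem_head.
    by move/ll' => [psi' psi'l <-]; exists psi' => //; rewrite inE psi'l orbT.
  move=> [l' [l'p ll']]; have [x /sat_ands xP] := fp l' l'p.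
  exists x => phi; rewrite ql => /ll'[psi psil <-].
  by rewrite /sat_over sat_rename rE; exact: xP.
exists x => phi pphi; rewrite -rE -sat_rename.
by apply: xP; exists phi.
Qed.

(** Zorn's lemma on partial assignments [(J, f)] compatible with every finite part of [p]. A maximal
    one is total: a further coordinate is realized by [saturated_one], with [d] and [f] as
    parameters, after quantifying the remaining coordinates existentially. *)
Lemma saturated_tuple (I D : Type) (d : D -> C) (p : set (formula L (I + D))) :
  smT K I -> smT K D -> fin_sat d p ->
  exists x, forall phi, p phi -> sat phi (tuple_cat x d).
Proof.
move=> sI sD fp.
pose good (s : set I * (I -> C)) := forall l, (forall phi, phi \in l -> p phi) ->
  exists x : I -> C, (forall i, s.1 i -> x i = s.2 i) /\ sat (ands l) (tuple_cat x d).
pose le (s t : {s | good s}) := (sval s).1 `<=` (sval t).1 /\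
  forall i, (sval s).1 i -> (sval s).2 i = (sval t).2 i.
have [c0] := carrier_nonempty C.
have g0 : good (set0, fun=> c0) by move=> l /fp[x hx]; exists x.
have [||F [s0 Fs0] Ftot|[[J f] /= fgood] fmax] :=
  @zorn_preorder {s | good s} (exist _ _ g0) le.
- by move=> s; split.
- move=> r s t [rs ers] [st est]; split; first exact: subset_trans st.
  by move=> i ri; rewrite ers // est //; exact: rs.
- pose J := \bigcup_(s in F) (sval s).1.
  have /choice[f fP] : forall i, exists c, forall s, F s -> (sval s).1 i ->
      (sval s).2 i = c.
    move=> i; have [[s Fs si]|nJ] := pselect (J i); last first.
      by exists c0 => s Fs si; case: nJ; exists s.
    exists ((sval s).2 i) => t Ft ti.
    by have [[_ st]|[_ ts]] := Ftot _ _ Fs Ft; [rewrite st|rewrite ts].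
  have Jgood : good (J, f).
    (* A finite part of [p] mentions finitely many coordinates; those in [J] all lie in the domain
       of one member of the chain. *)
    move=> l lp; have [li liP] := sat_support_left C (ands l).
    have [s [Fs sJ]] : exists s, F s /\ forall i, List.In i li -> J i -> (sval s).1 i.
      elim: li {liP} => [|i li [s [Fs sJ]]]; first by exists s0.
      have [[t Ft ti]|nJ] := pselect (J i); last first.
        by exists s; split=> // j [<-//|]; exact: sJ.
      have [[st _]|[ts _]] := Ftot _ _ Fs Ft.
        exists t; split=> // j [<-//|jl Jj]; exact/st/sJ.
      by exists s; split=> // j [<- _|]; [exact: ts|exact: sJ].
    have [x [xs xl]] := svalP s l lp.
    exists (fun i => if `[< J i >] then f i else x i); split=> [i Ji|] /=.
      by case: asboolP.
    rewrite (liP _ x) // => i il; case: asboolP => // Ji.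
    by rewrite xs; [rewrite (fP i s)//|]; exact: sJ.
  exists (exist _ _ Jgood) => s Fs; split=> [i si|i si] /=; first by exists s.
  exact: fP.
suff JT : forall i, J i.
  exists f => phi pphi; have [|x [xf]] := fgood [:: phi].
    by move=> psi; rewrite inE => /eqP ->.
  move/sat_ands => /(_ phi (mem_head _ _)).
  by have -> : x = f by apply: funext => i; exact: xf.
move=> i; apply: contrapT => nJi.
(* Coordinates in [J] become parameters, [i] becomes the variable to be realized, and the others are
   left to be quantified. *)
pose r (v : I + D) : I + (unit + (D + I)) :=
  match v with
  | inl j => if `[< J j >] then inr (inr (inr j))
             else if `[< j = i >] then inr (inl tt) else inl j
  | inr e => inr (inr (inl e))
  end.
have /choice[ex exP] := fun l => quantify_left C (rename r (ands l)).
have exE l u : sat (ex l) (tuple_cat u (tuple_cat d f)) <-> 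
    exists x : I -> C, [/\ forall j, J j -> x j = f j, x i = u tt &
      sat (ands l) (tuple_cat x d)].
  rewrite exP; split=> [[x]|[x [xf xi xl]]].
    rewrite sat_rename => h.
    exists (fun j => if `[< J j >] then f j else if `[< j = i >] then u tt else x j).
    split.
    - by move=> j Jj; case: asboolP.
    - by case: asboolP => // _; case: asboolP.
    - move: h; congr sat; apply: funext => -[j|//] /=.
      by case: asboolP => //= _; case: asboolP.
  exists x; rewrite sat_rename; move: xl; congr sat; apply: funext => -[j|//] /=.
  case: asboolP => [/xf//|_] /=; by case: asboolP => [->|].
have [||u uP] := saturated_one (d := tuple_cat d f)
  (p := [set ex l | l in [set l | forall phi, phi \in l -> p phi]]).
- by apply: smT_sum => //; exact: monster_infinite.
- move=> q qp.
  have [l [lp lq]] : exists l : seq (formula L (I + D)), (forall phi, phi \in l -> p phi) /\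
      forall u, sat (ex l) (tuple_cat u (tuple_cat d f)) ->
        sat (ands q) (tuple_cat u (tuple_cat d f)).
    elim: q qp => [|psi q IH] h; first by exists nil; split=> // u _.
    have [chi chiq|l [lp lq]] := IH; first by apply: h; rewrite inE chiq orbT.
    have [l' l'p l'psi] := h psi (mem_head _ _).
    exists (l' ++ l); split=> [phi|v].
      by rewrite mem_cat => /orP[/l'p|/lp].
    have -> : ands (psi :: q) = And psi (ands q) by [].
    rewrite exE sat_And => -[x [xf xi /ands_cat[xl' xl]]]; split.
      by rewrite -l'psi exE; exists x.
    by apply: lq; rewrite exE; exists x.
  have [x [xf xl]] := fgood l lp.
  by exists (fun=> x i); apply: lq; rewrite exE; exists x.
have g1 : good (J `|` [set i], upd f i (u tt)).
  move=> l lp; have /exE[x [xf xi xl]] : sat (ex l) (tuple_cat u (tuple_cat d f)).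
    by apply: uP; exists l.
  exists x; split=> //= j [Jj|->]; last by rewrite upd_same.
  by rewrite upd_other ?xf // => ji; apply: nJi; rewrite -ji.
have [|h _] := fmax (exist _ _ g1).
  split=> [j Jj|j Jj] /=; first by left.
  by rewrite upd_other // => ji; apply: nJi; rewrite -ji.
by apply: nJi; apply: h; right.
Qed.

Lemma automorphism_of_tuples (I : Type) (x y : I -> C) :
  smT K I -> (forall phi : formula L I, sat phi x <-> sat phi y) ->
  exists2 sigma : C -> C, automorphism sigma & sigma \o x = y.
Proof.
move=> sI xy.
have /choice[g gP] : forall a : range x, exists i, x i = val a.
  by move=> a; have [i _ xi] := set_mem (valP a); exists i.
have [||sigma sigmaA sP] := C_hom (A := range x) (f := y \o g).
- by apply/smallE; exact: smT_range.
- move=> phi.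
  have <- : x \o g = (fun a : range x => val a) by apply: funext.
  by rewrite -(sat_rename g x) -(sat_rename g y).
exists sigma => //; apply: funext => i /=.
pose a : range x := SigSub (mem_set (imageP x (Logic.I : setT i))).
have := sP a; rewrite /= => ->; set j := g _.
(* The index [j] chosen for the element [x i] may differ from [i]; the formula equating the two
   coordinates transfers [x j = x i] to [y]. *)
have xj : x j = x i by exact: gP.
have /= := xy (Eq (Var L i) (Var L j)); rewrite xj => -[h _].
by rewrite h.
Qed.

End Monster.

Lemma automorphism_sat (L : language) (C : structure L) (sigma : C -> C) :
  automorphism sigma -> forall (V : Type) (phi : formula L V) (s : V -> C),
  sat phi (sigma \o s) <-> sat phi s.
Proof.
move=> [[tau st ts] sf sr] V phi s.
have E W (t : term L W) (e : W -> C) : Defs.eval (sigma \o e) t = sigma (Defs.eval e t).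
  by elim: t => [//|g args IH] /=; rewrite sf; congr fun_interp; apply: funext.
elim: phi s => [|V' t u|V' r args|V' phi1 IH1 phi2 IH2|V' psi IH] s //=.
- by rewrite !E; split=> [|->//]; exact: can_inj st _ _.
- by rewrite (sr r (fun i => Defs.eval s (args i))); under eq_fun do rewrite E.
- by rewrite IH1 IH2.
- have F c : (fun v : option V' => if v is Some w then (sigma \o s) w else sigma c) =
      sigma \o ext_env s c by apply: funext => -[].
  split=> h c; first by have := h (sigma c); rewrite F IH.
  by have := h (tau c); rewrite -IH -F ts.
Qed.

(** * Small elementary submodels *)

Section Coding.
Variable L : language.

(** Trees over the symbols of the language serve to bound the number of formulas with variables in
    [nat]; under a quantifier [option_code] reserves 0 for the bound variable. *)
Fixpoint term_code (V : Type) (g : V -> nat) (t : term L V) :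
    GenTree.tree (nat + fun_sym L + rel_sym L) :=
  match t with
  | Var v => GenTree.Leaf (inl (inl (g v)))
  | App f args => GenTree.Node 0 (GenTree.Leaf (inl (inr f)) ::
      [seq term_code g (args i) | i <- enum 'I_(fun_arity f)])
  end.

Definition option_code (V : Type) (g : V -> nat) : option V -> nat :=
  fun v => if v is Some w then (g w).+1 else 0.

Fixpoint formula_code (V : Type) (g : V -> nat) (phi : formula L V) :
    GenTree.tree (nat + fun_sym L + rel_sym L) :=
  match phi with
  | Bot => GenTree.Node 0 [::]
  | Eq t u => GenTree.Node 1 [:: term_code g t; term_code g u]
  | Rel r args => GenTree.Node 2 (GenTree.Leaf (inr r) ::
      [seq term_code g (args i) | i <- enum 'I_(rel_arity r)])
  | Imp phi1 phi2 => GenTree.Node 3 [:: formula_code g phi1; formula_code g phi2]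
  | All psi => GenTree.Node 4 [:: formula_code (option_code g) psi]
  end.

Lemma map_enum_inj (T : Type) (n : nat) (f f' : 'I_n -> T) :
  [seq f i | i <- enum 'I_n] = [seq f' i | i <- enum 'I_n] -> f = f'.
Proof.
move=> e; apply: funext => i.
have : i \in enum 'I_n by rewrite mem_enum.
elim: (enum _) e => [//|j r IH] /= [ej er]; rewrite inE => /predU1P[->//|].
exact: IH.
Qed.

Lemma term_code_inj (V : Type) (g : V -> nat) :
  injective g -> injective (term_code g).
Proof.
move=> gi; elim=> [v|f args IH] [w|f' args'] //=.
  by move=> [/gi ->].
move=> [ef]; subst f' => /map_enum_inj e.
by congr App; apply: funext => i; apply: IH; exact: (congr1 (@^~ i) e).
Qed.

Lemma formula_code_inj (V : Type) (g : V -> nat) :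
  injective g -> injective (formula_code g).
Proof.
move=> gi phi; elim: phi g gi =>
  [V'|V' t u|V' r args|V' phi1 IH1 phi2 IH2|V' psi IH] g gi
  [|t' u'|r' args'|phi1' phi2'|psi'] //=.
- by move=> [/(term_code_inj gi) -> /(term_code_inj gi) ->].
- move=> [er]; subst r' => /map_enum_inj e.
  congr Rel; apply: funext => i; apply: (term_code_inj gi).
  exact: (congr1 (@^~ i) e).
- by move=> [/(IH1 _ gi) -> /(IH2 _ gi) ->].
- move=> [/IH ->] //.
  by move=> [v|] [w|] //= [] /gi ->.
Qed.

End Coding.

Lemma cle_tree (T : Type) : cle (GenTree.tree T) (seq (nat + T)).
Proof. by exists (@GenTree.encode T); exact: pcan_inj (GenTree.codeK T). Qed.

(* The Tarski-Vaught condition. *)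
Definition witnessed (L : language) (C : structure L) (M : set C) : Prop :=
  forall (V : Type) (chi : formula L (option V)) (s : V -> C),
    (forall v, M (s v)) -> (exists c, sat chi (ext_env s c)) ->
    exists2 c, M c & sat chi (ext_env s c).

Section LowenheimSkolem.
Variables (L : language) (C : structure L).

Lemma witnessed_elementary (M : set C) :
  M !=set0 -> witnessed M -> elementary_substructure M.
Proof.
move=> [m Mm] MW.
have M0 : inhabited M by constructor; exact: SigSub (mem_set Mm).
have Mf : fun_closed M.
  move=> f args; apply/mem_set.
  (* Closure under functions is the Tarski-Vaught condition for the formula equating the bound
     variable with the value of [f]. *)
  have [||c Mc] := MW _ (Eq (Var L None) (App (fun i => Var L (Some i))))
    (fun i => val (args i)).
  - by move=> i; exact/set_mem/valP.
  - by exists (fun_interp (fun i => val (args i))).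
  - by move=> /= <-.
exists M0, Mf.
suff H : forall V (phi : formula L V) (s : V -> M),
    @sat L (substructure M0 Mf) V phi s <-> @sat L C V phi (fun v => val (s v)).
  by move=> phi s; exact: H.
have E W (t : term L W) (s : W -> M) :
    val (@Defs.eval L (substructure M0 Mf) W s t) = Defs.eval (fun v => val (s v)) t.
  elim: t => [//|g args IH] /=; congr fun_interp.
  by apply: funext => i; exact: IH.
move=> V; elim=>{V} [|V' t u|V' r args|V' phi1 IH1 phi2 IH2|V' psi IH] s //=.
- rewrite -!E; split=> [->//|]; exact: val_inj.
- by under eq_fun do rewrite E.
- by rewrite IH1 IH2.
- have F (c : M) : (fun v => val (ext_env s c v)) = ext_env (fun v => val (s v)) (val c).
    by apply: funext => -[].
  split=> [h c|h c]; last first.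
    by have := IH (ext_env s c); rewrite F => -[_]; apply; exact: h.
  apply: contrapT => n.
  have [||e Me ne] := MW _ (Not psi) (fun v => val (s v)).
  + by move=> v; exact/set_mem/valP.
  + by exists c.
  apply: ne; have := IH (ext_env s (SigSub (mem_set Me))); rewrite F => -[+ _].
  by apply; exact: h.
Qed.

(** Formulas over arbitrary variable types reduce to formulas over [nat], which are few enough to be
    coded. Number 0 stands for the quantified variable and [n.+1] for entry [n] of [l]. *)
Lemma finite_parameters (V : Type) (chi : formula L (option V)) (s : V -> C) :
  exists chi' : formula L nat, exists l : seq V, forall c,
    sat chi (ext_env s c) <-> sat chi' (nth c (c :: map s l)).
Proof.
have [l lP] := sat_support C chi; pose l' := pmap id l.
have /choice[g gP] : forall v, exists n, List.In v l' ->
    forall c, nth c (map s l') n = s v.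
  move=> v; elim: l' => [|w r [n nP]] /=; first by exists 0.
  have [->|wv] := pselect (w = v); first by exists 0.
  by exists n.+1 => -[//|]; exact: nP.
exists (rename (option_code g) chi), l' => c; rewrite sat_rename.
suff -> : sat chi (ext_env s c) =
  sat chi (nth c (c :: map s l') \o option_code g) by [].
apply: lP => -[v|//] vl /=; rewrite gP //.
rewrite /l'; elim: l vl {gP g l'} => [//|[w|] l IH] /= [] //.
- by move=> [->]; left.
- by right; exact: IH.
Qed.

(** The model is a Skolem hull: the function [w] picks a witness for each formula and finite
    sequence of parameters whenever one exists. *)
Lemma small_model_containing (K A : Type) (a : A -> C) :
  small K [set: set (nat + fun_sym L + rel_sym L)] -> smT K A ->
  exists M : set C, [/\ small_model K M, M !=set0, witnessed M & forall i, M (a i)].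
Proof.
move=> K_big sA; have Kinf := monster_infinite K_big.
have [c0] := carrier_nonempty C.
have /choice[w wP] : forall p : formula L nat * seq C, exists c,
    (exists c, sat p.1 (nth c (c :: p.2))) -> sat p.1 (nth c (c :: p.2)).
  move=> p; have [[c pc]|n] := pselect (exists c, sat p.1 (nth c (c :: p.2))).
    by exists c.
  by exists c0.
(* Trees act as Skolem terms: a leaf is a generator, and a node headed by a formula applies the
   witness function to the values of its subtrees. Other trees get the default [c0]. *)
pose fix sk (t : GenTree.tree (A + formula L nat)) : C :=
  match t with
  | GenTree.Leaf (inl i) => a i
  | GenTree.Node _ (GenTree.Leaf (inr phi) :: ts) => w (phi, map sk ts)
  | _ => c0
  end.
exists (range sk).
have MW : witnessed (range sk).
  move=> V chi s sM; have [chi' [l lP]] := finite_parameters chi s.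
  have /choice[t tP] : forall v, exists t, sk t = s v.
    by move=> v; have [t _ ts] := sM v; exists t.
  move=> [c /lP hc].
  have e : map sk (map t l) = map s l by rewrite -map_comp; apply: eq_map.
  exists (w (chi', map s l)); last by apply/lP/(wP (chi', map s l)); exists c.
  exists (GenTree.Node 0 (GenTree.Leaf (inr chi') :: map t l)) => //=.
  by rewrite e.
have M0 : range sk !=set0 by exists (sk (GenTree.Node 0 [::])); exact: imageP.
split=> //; last by move=> i; exists (GenTree.Leaf (inl i)).
split; last exact: witnessed_elementary.
apply/smallE/smT_range; apply: smT_le (@cle_tree _) _.
apply: (smT_seq Kinf); apply: (smT_sum Kinf) => //; apply: (smT_sum Kinf) => //.
apply: smT_le (ex_intro _ _ (@formula_code_inj L nat id (fun _ _ e => e))) _.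
apply: smT_le (@cle_tree _) _; apply: (smT_seq Kinf); apply: (smT_sum Kinf) => //.
exact: monster_language.
Qed.

End LowenheimSkolem.

(** * Type-definability and coheirs *)

Section Definability.
Variables (L : language) (C : structure L).

Lemma tuple_cat_inj (I J S : Type) (x x' : I -> S) (y y' : J -> S) :
  tuple_cat x y = tuple_cat x' y' -> x = x' /\ y = y'.
Proof.
by move=> e; split; apply: funext => i;
  [exact: (congr1 (@^~ (inl i)) e)|exact: (congr1 (@^~ (inr i)) e)].
Qed.

Lemma comp_tuple_cat (I J S S' : Type) (f : S -> S') (x : I -> S) (y : J -> S) :
  f \o tuple_cat x y = tuple_cat (f \o x) (f \o y).
Proof. by apply: funext => -[]. Qed.

Definition tdef (V : Type) (P : set (V -> C)) : Prop :=
  exists p : set (formula L V), forall s, P s <-> forall phi, p phi -> sat phi s.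

Lemma type_definable0 (V : Type) (P : set (V -> C)) :
  type_definable set0 P -> tdef P.
Proof.
move=> [p ->].
pose r (v : V + (set0 : set C)) : V :=
  match v with inl w => w | inr a => False_rect V (set_mem (valP a)) end.
have E (s : V -> C) : s \o r = tuple_cat s (fun a : (set0 : set C) => val a).
  by apply: funext => -[//|a]; case: (set_mem (valP a)).
exists [set rename r phi | phi in p] => s; split=> [h _ [phi pphi <-]|h phi pphi].
  by rewrite sat_rename E; exact: h.
by rewrite /sat_over -E -sat_rename; apply: h; exists phi.
Qed.

Lemma tdef_rename (V W : Type) (r : W -> V) (P : set (W -> C)) :
  tdef P -> tdef (fun s => P (s \o r)).
Proof.
move=> [p pP]; exists [set rename r phi | phi in p] => s /=; rewrite pP; split.
  by move=> h _ [phi pphi <-]; rewrite sat_rename; exact: h.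
by move=> h phi pphi; rewrite -sat_rename; apply: h; exists phi.
Qed.

Lemma tdef_automorphism (sigma : C -> C) (V : Type) (P : set (V -> C)) s :
  automorphism sigma -> tdef P -> P (sigma \o s) <-> P s.
Proof.
move=> sA [p pP]; rewrite !pP; split=> h phi pphi.
  by apply/(automorphism_sat sA); exact: h.
by apply/(automorphism_sat sA); exact: h.
Qed.

(** Equality of types over [d]; one implication suffices, since formulas can be negated. *)
Definition eqtp (I D : Type) (d : D -> C) (x y : I -> C) : Prop :=
  forall phi : formula L (I + D), sat phi (tuple_cat x d) -> sat phi (tuple_cat y d).

Lemma eqtp_iff (I D : Type) (d : D -> C) (x y : I -> C) phi :
  eqtp d x y -> sat phi (tuple_cat x d) <-> sat phi (tuple_cat y d).
Proof.
move=> xy; split=> [/xy//|h]; apply: contrapT => n.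
by have := xy (Not phi) n; rewrite sat_Not.
Qed.

Lemma eqtp_sym (I D : Type) (d : D -> C) (x y : I -> C) : eqtp d x y -> eqtp d y x.
Proof. by move=> xy phi; rewrite -(eqtp_iff _ xy). Qed.

Lemma eqtp_trans (I D : Type) (d : D -> C) (x y z : I -> C) :
  eqtp d x y -> eqtp d y z -> eqtp d x z.
Proof. by move=> xy yz phi /xy/yz. Qed.

Lemma automorphism_eqtp (sigma : C -> C) (I D : Type) (d : D -> C) (x : I -> C) :
  automorphism sigma -> sigma \o d = d -> eqtp d x (sigma \o x).
Proof.
move=> sA sd phi h.
by rewrite -[in tuple_cat _ _]sd -comp_tuple_cat; apply/(automorphism_sat sA).
Qed.

End Definability.

(** * Compactness, pullbacks along type-definable functions, and coheirs *)

Section Monster.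
Variables (K : Type) (L : language) (C : structure L).
Hypothesis K_big : small K [set: set (nat + fun_sym L + rel_sym L)].
Hypothesis C_sat : saturated K C.
Hypothesis C_hom : homogeneous K C.

Let Kinf := monster_infinite K_big.

Lemma eqtp_automorphism (I D : Type) (d : D -> C) (x y : I -> C) :
  smT K I -> smT K D -> eqtp d x y ->
  exists sigma, [/\ automorphism sigma, sigma \o d = d & sigma \o x = y].
Proof.
move=> sI sD xy.
have [|sigma sA] := automorphism_of_tuples C_hom (smT_sum Kinf sI sD)
  (x := tuple_cat x d) (y := tuple_cat y d).
  by move=> phi; exact: eqtp_iff.
by rewrite comp_tuple_cat => /tuple_cat_inj[? ?]; exists sigma.
Qed.

(** Compactness for sets that need not be definable: the formulas holding throughout some member of
    a directed family of nonempty sets are finitely satisfiable. *)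
Lemma saturated_directed (I D T : Type) (d : D -> C) (B : T -> set (I -> C)) (t0 : T) :
  smT K I -> smT K D ->
  (forall t u, exists v, B v `<=` B t `&` B u) -> (forall t, B t !=set0) ->
  exists x, forall t phi, (forall z, B t z -> sat phi (tuple_cat z d)) ->
    sat phi (tuple_cat x d).
Proof.
move=> sI sD Bdir B0.
have [|x xP] := saturated_tuple K_big C_sat (d := d) sI sD
  (p := [set phi | exists t, forall z, B t z -> sat phi (tuple_cat z d)]).
  move=> l lp.
  have [t tP] : exists t, forall z, B t z -> sat (ands l) (tuple_cat z d).
    elim: l lp => [|phi l IH] h; first by exists t0 => z _ [].
    have [psi psil|t tP] := IH; first by apply: h; rewrite inE psil orbT.
    have [u uP] := h phi (mem_head _ _); have [v vP] := Bdir t u.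
    exists v => z /vP[/tP zl /uP zphi].
    have -> : ands (phi :: l) = And phi (ands l) by [].
    by rewrite sat_And.
  by have [z /tP zl] := B0 t; exists z.
by exists x => t phi h; apply: xP; exists t.
Qed.

(* By compactness a finite part [R0] of [R] already excludes that [R0 x y],
   [phi y], [R0 x y'] and [~ phi y'] hold together, and [psi x] says that [R0 x y]
   and [phi y] hold for some [y]. *)
Lemma pullback (I J D : Type) (d : D -> C) (R : set (J + (I + D) -> C)) :
  smT K I -> smT K J -> smT K D -> tdef R ->
  (forall x y y', R (tuple_cat y (tuple_cat x d)) ->
     R (tuple_cat y' (tuple_cat x d)) -> y = y') ->
  forall phi : formula L (J + D), exists psi : formula L (I + D), forall x y,
    R (tuple_cat y (tuple_cat x d)) ->
    sat psi (tuple_cat x d) <-> sat phi (tuple_cat y d).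
Proof.
move=> sI sJ sD [p pR] Rfun phi.
(* [B l] collects the counterexamples surviving the part of [l] that lies in [p]. If no [B l] were
   empty, saturation would give two equal values of [R] that disagree on [phi]. *)
pose B (l : seq (formula L (J + (I + D)))) : set (I + (J + J) -> C) :=
  [set z : I + (J + J) -> C | [/\ forall chi, chi \in l -> p chi ->
      sat chi (tuple_cat (z \o inr \o inl) (tuple_cat (z \o inl) d)) /\
      sat chi (tuple_cat (z \o inr \o inr) (tuple_cat (z \o inl) d)),
      sat phi (tuple_cat (z \o inr \o inl) d) &
      ~ sat phi (tuple_cat (z \o inr \o inr) d)]].
have [Bn0|/existsNP[l Bl]] := pselect (forall l, B l !=set0).
  have [||z zP] := @saturated_directed (I + (J + J)) D _ d B [::] _ sD _ Bn0.
  - by do 2?[apply: (smT_sum Kinf) => //].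
  - move=> l l'; exists (l ++ l') => z [zl z1 z2].
    by split; split=> // chi chil; apply: zl; rewrite mem_cat chil ?orbT.
  exfalso.
  have zr (W : Type) (r : W -> I + (J + J) + D) (chi : formula L W) l :
      (forall z, B l z -> sat chi (tuple_cat z d \o r)) ->
      sat chi (tuple_cat z d \o r).
    move=> h; rewrite -sat_rename; apply: (zP l) => z' /h.
    by rewrite sat_rename.
  pose r1 (v : J + (I + D)) : I + (J + J) + D := match v with
    | inl j => inl (inr (inl j)) | inr (inl i) => inl (inl i)
    | inr (inr e) => inr e end.
  pose r2 (v : J + (I + D)) : I + (J + J) + D := match v with
    | inl j => inl (inr (inr j)) | inr (inl i) => inl (inl i)
    | inr (inr e) => inr e end.
  pose s1 (v : J + D) : I + (J + J) + D := match v with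
    | inl j => inl (inr (inl j)) | inr e => inr e end.
  pose s2 (v : J + D) : I + (J + J) + D := match v with
    | inl j => inl (inr (inr j)) | inr e => inr e end.
  have r1E z' : tuple_cat z' d \o r1 =
      tuple_cat (z' \o inr \o inl) (tuple_cat (z' \o inl) d).
    by apply: funext => -[|[]].
  have r2E z' : tuple_cat z' d \o r2 =
      tuple_cat (z' \o inr \o inr) (tuple_cat (z' \o inl) d).
    by apply: funext => -[|[]].
  have s1E z' : tuple_cat z' d \o s1 = tuple_cat (z' \o inr \o inl) d.
    by apply: funext => -[].
  have s2E z' : tuple_cat z' d \o s2 = tuple_cat (z' \o inr \o inr) d.
    by apply: funext => -[].
  have R1 : R (tuple_cat (z \o inr \o inl) (tuple_cat (z \o inl) d)).
    rewrite pR => chi pchi; rewrite -r1E; apply: (zr _ _ _ [:: chi]) => z'.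
    by rewrite r1E => -[/(_ chi (mem_head _ _) pchi)[]].
  have R2 : R (tuple_cat (z \o inr \o inr) (tuple_cat (z \o inl) d)).
    rewrite pR => chi pchi; rewrite -r2E; apply: (zr _ _ _ [:: chi]) => z'.
    by rewrite r2E => -[/(_ chi (mem_head _ _) pchi)[]].
  have : sat (Not phi) (tuple_cat z d \o s2).
    by apply: (zr _ _ _ [::]) => z' [_ _]; rewrite s2E.
  rewrite sat_Not; apply.
  have := zr _ s1 phi [::]; rewrite s1E s2E (Rfun _ _ _ R1 R2); apply=> z'.
  by rewrite s1E => -[].
pose l0 := [seq chi <- l | `[< p chi >]].
have l0P chi : chi \in l0 -> p chi by rewrite mem_filter => /andP[/asboolP].
pose r (v : J + D) : J + (I + D) := match v with
  | inl j => inl j | inr e => inr (inr e) end.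
have [psi psiP] := quantify_left C (And (ands l0) (rename r phi)).
have rE x y : tuple_cat y (tuple_cat x d) \o r = tuple_cat y d.
  by apply: funext => -[].
exists psi => x y Rxy; rewrite psiP.
have sl0 : sat (ands l0) (tuple_cat y (tuple_cat x d)).
  by apply/sat_ands => chi /l0P; move: chi; apply/pR.
split=> [[y']|yphi]; last by exists y; rewrite sat_And sat_rename rE.
rewrite sat_And sat_rename rE => -[sl0' y'phi]; apply: contrapT => n.
apply: Bl; exists (tuple_cat x (tuple_cat y' y)); split=> // chi chil pchi.
have chil0 : chi \in l0 by rewrite mem_filter chil andbT; apply/asboolP.
by split; [move/sat_ands: sl0' => /(_ _ chil0)|move/sat_ands: sl0 => /(_ _ chil0)].
Qed.

(** Realization over [d] of the average type of [U]. When [U] is an ultrafilter containing the set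
    of tuples from a model, this type is a coheir over that model. *)
Definition realizes (I D : Type) (U : set_system (I -> C)) (d : D -> C)
    (c : I -> C) : Prop :=
  forall phi : formula L (I + D),
    U [set z | sat phi (tuple_cat z d)] -> sat phi (tuple_cat c d).

Lemma realizes_ex (I D : Type) (U : set_system (I -> C)) (d : D -> C) :
  ProperFilter U -> smT K I -> smT K D -> exists c, realizes U d c.
Proof.
move=> UF sI sD.
have [||c cP] := @saturated_directed I D {A | U A} d sval
    (exist _ _ (@filterT _ U _)) sI sD.
- move=> [A UA] [B UB]; by exists (exist _ _ (filterI UA UB)).
- by move=> [A UA]; exact: filter_ex UA.
by exists c => phi Uphi; exact: (cP (exist _ _ Uphi)).
Qed.

Lemma realizes_iff (I D : Type) (U : set_system (I -> C)) (d : D -> C) c phi :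
  UltraFilter U -> realizes U d c ->
  sat phi (tuple_cat c d) <-> U [set z | sat phi (tuple_cat z d)].
Proof.
move=> UU cU; split=> [h|/cU//].
have [//|n] := in_ultra_setVsetC [set z | sat phi (tuple_cat z d)] UU.
by case: ((cU (Not phi) n : ~ sat phi _) h).
Qed.

Lemma realizes_eqtp (I D : Type) (U : set_system (I -> C)) (d : D -> C) c c' :
  UltraFilter U -> realizes U d c -> realizes U d c' -> eqtp d c c'.
Proof. by move=> UU cU c'U phi /(realizes_iff _ UU cU)/c'U. Qed.

Lemma realizes_sub (I D D' : Type) (U : set_system (I -> C)) (d : D -> C)
    (k : D' -> D) c :
  Filter U -> realizes U d c -> realizes U (d \o k) c.
Proof.
move=> UF cU phi h.
pose r (v : I + D') : I + D := match v with inl i => inl i | inr e => inr (k e) end.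
have rE x : tuple_cat x d \o r = tuple_cat x (d \o k) by apply: funext => -[].
rewrite -rE -sat_rename; apply: cU; apply: filterS h => z /=.
by rewrite sat_rename rE.
Qed.

(* Coheirs are invariant: with [U] concentrated on tuples from the model, the
   type of a realization over [x] only depends on the type of [x] over [M]. *)
Lemma coheir_invariant (M : set C) (I J : Type) (U : set_system (I -> C))
    (x y : J -> C) (c c' : I -> C) (m := fun e : M => val e) :
  smT K M -> smT K I -> smT K J -> UltraFilter U ->
  U [set z | forall i, M (z i)] -> eqtp m x y ->
  realizes U (tuple_cat m x) c -> realizes U (tuple_cat m y) c' ->
  exists sigma, [/\ automorphism sigma, sigma \o m = m, sigma \o x = y &
    sigma \o c = c'].
Proof.
move=> sM sI sJ UU UM xy cx c'y.
have [||sigma sA sE] := automorphism_of_tuples C_hom (I := I + (M + J))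
    (x := tuple_cat c (tuple_cat m x)) (y := tuple_cat c' (tuple_cat m y)).
- by do 2?[apply: (smT_sum Kinf) => //].
- move=> phi; rewrite (realizes_iff _ UU cx) (realizes_iff _ UU c'y).
  suff E z : (forall i, M (z i)) -> sat phi (tuple_cat z (tuple_cat m x)) <->
      sat phi (tuple_cat z (tuple_cat m y)).
    by split=> h; apply: filterS (filterI UM h) => z [/E zM]; rewrite /= zM.
  move=> zM.
  (* As [z] comes from [M], its coordinates can be renamed to parameters, which leaves a formula
     over [M] about [x] alone. *)
  pose r (v : I + (M + J)) : J + M := match v with
    | inl i => inr (SigSub (mem_set (zM i)))
    | inr (inl e) => inr e | inr (inr j) => inl j end.
  have rE w : tuple_cat w m \o r = tuple_cat z (tuple_cat m w).
    by apply: funext => -[|[]].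
  by rewrite -!rE -(sat_rename r (tuple_cat x m)) -(sat_rename r (tuple_cat y m));
     exact: eqtp_iff.
move: sE; rewrite !comp_tuple_cat => /tuple_cat_inj[? /tuple_cat_inj[? ?]].
by exists sigma.
Qed.

End Monster.

(** * Actions *)

Section Action.
Variables (K : Type) (L : language) (C : structure L) (alpha beta : Type).
Variable F : Fsigma_action K C alpha beta.
Hypothesis K_big : small K [set: set (nat + fun_sym L + rel_sym L)].
Hypothesis C_sat : saturated K C.
Hypothesis C_hom : homogeneous K C.

Let Kinf := monster_infinite K_big.
Local Notation G := (fsG F).
Local Notation H := (fsH F).
Local Notation V := (fsV F).
Local Notation X := (fsX F).
Local Notation "g ** x" := (fs_act F g x) (at level 36, right associativity).
Local Notation inv := (fs_inv F).
Local Notation U n x y := (fsU F n (x, y)).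
Local Notation E x y := (fsE F (x, y)).
Implicit Types (g h : beta -> C) (x y z : alpha -> C).

Lemma fsGH g : G g -> H g.
Proof. exact: subgroup_sub (fsG_subgroup F) g. Qed.

Lemma fsVG n g : V n g -> G g.
Proof. by rewrite (fsG_bigcup F); exists n. Qed.

Lemma fsVH n g : V n g -> H g.
Proof. by move/fsVG/fsGH. Qed.

Lemma fsGV g : G g -> exists n, V n g.
Proof. by rewrite {1}(fsG_bigcup F) => -[n _ ?]; exists n. Qed.

Lemma fsH1 : H (fs_one F). Proof. exact: group_one (fsH_group F). Qed.

Lemma fsHM g h : H g -> H h -> H (fs_mul F g h).
Proof. exact: group_mul (fsH_group F) g h. Qed.

Lemma fsHV g : H g -> H (inv g).
Proof. exact: group_inv (fsH_group F) g. Qed.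

Lemma fsGinv g : G g -> G (inv g).
Proof. exact: subgroup_inv (fsG_subgroup F) g. Qed.

Lemma actX g x : H g -> X x -> X (g ** x).
Proof. exact: action_closed (fs_action F) g x. Qed.

Lemma act1 x : X x -> fs_one F ** x = x.
Proof. exact: action_one (fs_action F) x. Qed.

Lemma actM g h x : H g -> H h -> X x -> fs_mul F g h ** x = g ** h ** x.
Proof. exact: action_mul (fs_action F) g h x. Qed.

Lemma actK g x : H g -> X x -> inv g ** g ** x = x.
Proof.
move=> Hg Xx; rewrite -actM ?(group_mulVg (fsH_group F)) ?act1 //.
exact: fsHV.
Qed.

Lemma actKV g x : H g -> X x -> g ** inv g ** x = x.
Proof.
move=> Hg Xx; rewrite -actM ?(group_mulgV (fsH_group F)) ?act1 //.
exact: fsHV.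
Qed.

Lemma actVV g x : H g -> X x -> inv (inv g) ** x = g ** x.
Proof.
move=> Hg Xx; rewrite -{1}(actK Hg Xx) actK //; first exact: fsHV.
exact: actX.
Qed.

Lemma fsVinv n g : V n g -> V n (inv g).
Proof. by move=> Vg; rewrite (fsV_inv F n); exists g. Qed.

Lemma fsVM n g h : V n g -> V n h -> V n.+1 (fs_mul F g h).
Proof. move=> Vg Vh; have := @fsV_mul _ _ _ _ _ F n (fs_mul F g h); apply.
by exists g => //; exists h. Qed.

Lemma fsV_le n m g : n <= m -> V n g -> V m g.
Proof.
move=> /subnK <-; elim: (m - n) => [//|k IH] /IH Vg.
rewrite addSn -(group_mulg1 (fsH_group F) (fsVH Vg)).
by apply: fsVM => //; exact: fsV_one.
Qed.

Lemma fsU_X n x y : U n x y -> X x /\ X y.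
Proof. by case. Qed.

Lemma fsU_le n m x y : n <= m -> U n x y -> U m x y.
Proof.
by move=> nm [Xx Xy [g Vg gx]]; split=> //; exists g => //; exact: fsV_le Vg.
Qed.

Lemma fsU_act n g x : V n g -> X x -> U n x (g ** x).
Proof.
by move=> Vg Xx; split=> //=; [apply: actX => //; exact: fsVH Vg|exists g].
Qed.

Lemma fsU_refl n x : X x -> U n x x.
Proof.
by move=> Xx; rewrite -{2}(act1 Xx); apply: fsU_act => //; exact: fsV_one.
Qed.

Lemma fsU_sym n x y : U n x y -> U n y x.
Proof.
move=> [/= Xx Xy [g Vg gx]]; split=> //; exists (inv g); first exact: fsVinv.
by rewrite /= -gx actK //; exact: fsVH Vg.
Qed.

Lemma fsU_trans n m x y z : U n x y -> U m y z -> U (n + m).+1 x z.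
Proof.
move=> /(fsU_le (leq_addr m n)) [/= Xx Xy [g Vg gx]].
move=> /(fsU_le (leq_addl n m)) [/= _ Xz [h Vh hx]].
split=> //; exists (fs_mul F h g); first exact: fsVM.
by rewrite /= actM ?gx //; [exact: fsVH Vh|exact: fsVH Vg].
Qed.

Lemma fsEU x y : E x y <-> exists n, U n x y.
Proof.
split=> [[Xx Xy [g Gg gx]]|[n [Xx Xy [g Vg gx]]]].
  by have [n Vg] := fsGV Gg; exists n; split=> //; exists g.
by split=> //; exists g => //; exact: fsVG Vg.
Qed.

Lemma fsE_sym x y : E x y -> E y x.
Proof. by rewrite !fsEU => -[n h]; exists n; exact: fsU_sym. Qed.

Lemma fsE_refl x : X x -> E x x.
Proof. by move=> Xx; apply/fsEU; exists 0; exact: fsU_refl. Qed.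

Lemma fsE_act g x : G g -> X x -> E x (g ** x).
Proof.
by move=> /fsGV[n Vg] Xx; apply/fsEU; exists n; exact: fsU_act.
Qed.

(** Inverting an element preserves bounds on how far it moves [a], even when measured from [v ** a].
    Right shiftiness is applied to the identity and the product of [g] and [v], left shiftiness to
    [inv g] and [v]; the element [v] costs at most [k]. *)
Lemma shifty_norm a : shifty F a -> forall k, exists k', forall g v,
  G g -> V k v -> U k (g ** v ** a) a -> U k' (inv g ** a) a.
Proof.
move=> [Xa sh] k.
have key g v : G g -> V k v -> [/\ H g, H v & X (inv g ** a)].
  move=> Gg Vv; split; [exact: fsGH|exact: fsVH Vv|].
  by apply: actX => //; exact/fsHV/fsGH.
case: sh => [sh|sh]; have [n nP] := sh k; exists (k + n).+1 => g v Gg Vv.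
  have [Hg Hv Xga] := key _ _ Gg Vv; have Hgv := fsHM Hg Hv.
  rewrite -actM // => /fsU_sym; rewrite -{1}(act1 Xa) => /nP-/(_ fsH1 Hgv).
  rewrite (group_mul1g (fsH_group F) (fsHV Hgv)) => Ua.
  set w := inv _ ** a in Ua; have [Xw _] := fsU_X Ua.
  have -> : inv g ** a = v ** w.
    rewrite -(actK Hg (actX Hv Xw)); congr (_ ** _).
    by rewrite -actM // actKV.
  by apply: fsU_trans Ua; exact: fsU_sym (fsU_act Vv Xw).
have [Hg Hv Xga] := key _ _ Gg Vv.
have [_] := nP (inv g) v (fsHV Hg) Hv.
have Hgg := fsHV (fsHV Hg); have Xva := actX Hv Xa.
rewrite actM // actVV //.
move=> + Ug => /(_ Ug) Ua; rewrite addnC.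
by apply: fsU_trans Ua _; exact: fsU_sym (fsU_act Vv Xa).
Qed.

(** Right shiftiness is applied to the inverses of [h0] and [h1], left shiftiness to [h0] and [h1]
    themselves. *)
Lemma shifty_quotient a h0 h1 : shifty F a -> H h0 -> H h1 ->
  E (h0 ** a) (h1 ** a) -> E (inv h0 ** a) (inv h1 ** a) ->
  E a (inv h0 ** h1 ** a).
Proof.
move=> [Xa sh] H0 H1 /fsEU[k Uk] /fsEU[k' Uk'].
apply: fsE_sym; apply/fsEU.
case: sh => [/(_ k')|/(_ k)] [n nP]; exists n.
  have := nP _ _ (fsHV H0) (fsHV H1) Uk'; rewrite actM //; try exact: fsHV.
    by rewrite actVV.
  exact/fsHV/fsHV.
have [+ _] := nP _ _ H0 H1; move=> /(_ Uk); rewrite actM //; exact: fsHV.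
Qed.

Definition act_graph : set (beta + alpha + alpha -> C) := op_graph H X (fs_act F).

Lemma act_graphE g x y :
  act_graph (tuple_cat (tuple_cat g x) y) <-> [/\ H g, X x & g ** x = y].
Proof.
split=> [[g' Hg' [x' Xx' e]]|[Hg Xx <-]]; last by exists g => //; exists x.
have [/tuple_cat_inj[-> ->] ->] := tuple_cat_inj (esym e).
by split.
Qed.

Lemma act_graph_tdef : tdef act_graph.
Proof. exact/type_definable0/fs_act_def. Qed.

Lemma fsX_tdef : tdef X. Proof. exact/type_definable0/fsX_def. Qed.
Lemma fsH_tdef : tdef H. Proof. exact/type_definable0/fsH_def. Qed.
Lemma fsV_tdef n : tdef (V n). Proof. exact/type_definable0/fsV_def. Qed.

Section Automorphism.
Variable sigma : C -> C.
Hypothesis sA : automorphism sigma.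

Lemma aut_X x : X x -> X (sigma \o x).
Proof. by move=> Xx; apply/(tdef_automorphism _ sA fsX_tdef). Qed.

Lemma aut_H g : H g -> H (sigma \o g).
Proof. by move=> Hg; apply/(tdef_automorphism _ sA fsH_tdef). Qed.

Lemma aut_V n g : V n g -> V n (sigma \o g).
Proof. by move=> Vg; apply/(tdef_automorphism _ sA (fsV_tdef n)). Qed.

Lemma aut_act g x : H g -> X x -> sigma \o (g ** x) = (sigma \o g) ** (sigma \o x).
Proof.
move=> Hg Xx.
have /(tdef_automorphism _ sA act_graph_tdef) :
  act_graph (tuple_cat (tuple_cat g x) (g ** x)) by apply/act_graphE.
by rewrite !comp_tuple_cat => /act_graphE[_ _ ->].
Qed.

Lemma aut_U n x y : U n x y -> U n (sigma \o x) (sigma \o y).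
Proof.
move=> [/= Xx Xy [g Vg gx]]; split; [exact: aut_X|exact: aut_X|].
exists (sigma \o g); first exact: aut_V.
by rewrite /= -gx -aut_act //; exact: fsVH Vg.
Qed.

Lemma aut_actV g x : H g -> X x ->
  sigma \o (inv g ** x) = inv (sigma \o g) ** (sigma \o x).
Proof.
move=> Hg Xx.
have Xgx : X (inv g ** x) by apply: actX => //; exact: fsHV.
rewrite -{2}(actKV Hg Xx) (aut_act Hg Xgx) actK //; first exact: aut_H.
exact: aut_X.
Qed.

End Automorphism.

Section Pullback.
Variables (D : Type) (d : D -> C).
Hypothesis (alpha_small : smT K alpha) (beta_small : smT K beta) (D_small : smT K D).

(** Translation is definable only up to type-definability of its graph, so [pullback] supplies the
    formula; [k] locates the acting element among the parameters. *)
Lemma pullback_translation (k : beta -> D) (phi : formula L (alpha + D)) :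
  H (d \o k) -> exists psi : formula L (alpha + D), forall x, X x ->
    sat psi (tuple_cat x d) <-> sat phi (tuple_cat ((d \o k) ** x) d).
Proof.
move=> Hk.
pose r (v : beta + alpha + alpha) : alpha + (alpha + D) :=
  match v with inl (inl b) => inr (inr (k b)) | inl (inr i) => inr (inl i)
  | inr i => inl i end.
have rE x y : tuple_cat y (tuple_cat x d) \o r = tuple_cat (tuple_cat (d \o k) x) y.
  by apply: funext => -[[]|].
have [|psi psiP] := @pullback K L C K_big C_sat _ _ _ d _ alpha_small alpha_small
  D_small (tdef_rename r act_graph_tdef) _ phi.
  by move=> x y y'; rewrite !rE => /act_graphE[_ _ <-] /act_graphE[_ _ <-].
exists psi => x Xx; apply: psiP; rewrite rE.
exact/act_graphE.
Qed.

Lemma pullback_orbit_map (k : alpha -> D) (phi : formula L (alpha + D)) :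
  X (d \o k) -> exists psi : formula L (beta + D), forall h, H h ->
    sat psi (tuple_cat h d) <-> sat phi (tuple_cat (h ** (d \o k)) d).
Proof.
move=> Xk.
pose r (v : beta + alpha + alpha) : alpha + (beta + D) :=
  match v with inl (inl b) => inr (inl b) | inl (inr i) => inr (inr (k i))
  | inr i => inl i end.
have rE h y : tuple_cat y (tuple_cat h d) \o r = tuple_cat (tuple_cat h (d \o k)) y.
  by apply: funext => -[[]|].
have [|psi psiP] := @pullback K L C K_big C_sat _ _ _ d _ beta_small alpha_small
  D_small (tdef_rename r act_graph_tdef) _ phi.
  by move=> x y y'; rewrite !rE => /act_graphE[_ _ <-] /act_graphE[_ _ <-].
exists psi => h Hh; apply: psiP; rewrite rE.
exact/act_graphE.
Qed.

(** The graph of the action, read with its two points exchanged, is the graph of the action of the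
    inverse. *)
Lemma pullback_inverse_orbit_map (k : alpha -> D) (phi : formula L (alpha + D)) :
  X (d \o k) -> exists psi : formula L (beta + D), forall h, H h ->
    sat psi (tuple_cat h d) <-> sat phi (tuple_cat (inv h ** (d \o k)) d).
Proof.
move=> Xk.
pose r (v : beta + alpha + alpha) : alpha + (beta + D) :=
  match v with inl (inl b) => inr (inl b) | inl (inr i) => inl i
  | inr i => inr (inr (k i)) end.
have rE h y : tuple_cat y (tuple_cat h d) \o r = tuple_cat (tuple_cat h y) (d \o k).
  by apply: funext => -[[]|].
have [|psi psiP] := @pullback K L C K_big C_sat _ _ _ d _ beta_small alpha_small
  D_small (tdef_rename r act_graph_tdef) _ phi.
  move=> h y y'; rewrite !rE => /act_graphE[Hh Xy hy] /act_graphE[_ Xy' hy'].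
  by rewrite -(actK Hh Xy) hy -hy' actK.
exists psi => h Hh; apply: psiP; rewrite rE.
apply/act_graphE; split=> //; last exact: actKV.
by apply: actX => //; exact: fsHV.
Qed.

End Pullback.

End Action.

(** * Bounded actions *)

Section Bounded.
Variables (K : Type) (L : language) (C : structure L) (alpha beta : Type).
Variable F : Fsigma_action K C alpha beta.
Hypothesis K_big : small K [set: set (nat + fun_sym L + rel_sym L)].
Hypothesis C_sat : saturated K C.
Hypothesis C_hom : homogeneous K C.
Hypothesis (alpha_small : smT K alpha) (beta_small : smT K beta).
Hypothesis F_bounded : fs_bounded F.
Variable M : set C.
Hypothesis (M_small : smT K M) (M0 : M !=set0) (M_witnessed : witnessed M).

Let Kinf := monster_infinite K_big.
Local Notation H := (fsH F).
Local Notation X := (fsX F).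
Local Notation "g ** x" := (fs_act F g x) (at level 36, right associativity).
Local Notation inv := (fs_inv F).
Local Notation U n x y := (fsU F n (x, y)).
Local Notation E x y := (fsE F (x, y)).
Local Notation m := (fun e : M => val e).

Lemma m_in (e : M) : M (m e).
Proof. exact/set_mem/valP. Qed.

(** Each formula of the type of [b] over [M] is satisfied by a tuple from [M], by [tuple_witness];
    the resulting filter base extends to an ultrafilter. *)
Lemma coheir_ex (I : Type) (b : I -> C) : exists Uf : set_system (I -> C),
  [/\ UltraFilter Uf, Uf [set z | forall i, M (z i)] &
    forall phi, sat phi (tuple_cat b m) -> Uf [set z | sat phi (tuple_cat z m)]].
Proof.
pose B (phi : formula L (I + M)) : set (I -> C) :=
  [set z | (forall i, M (z i)) /\ sat phi (tuple_cat z m)].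
pose D : set (formula L (I + M)) := [set phi | sat phi (tuple_cat b m)].
have DB : ProperFilter (filter_from D B).
  apply: filter_from_proper; last first.
    move=> phi phib; have [z zM zphi] := tuple_witness M0 M_witnessed m_in phib.
    by exists z.
  apply: filter_from_filter; first by exists (Not Bot).
  move=> phi psi phib psib; exists (And phi psi); first by rewrite /D /mkset sat_And.
  by move=> z [zM]; rewrite sat_And => -[? ?]; split; split.
have [Uf [UU sU]] := ultraFilterLemma DB.
exists Uf; split=> // [|phi phib]; apply: sU.
  by exists (Not Bot) => // z [].
by exists phi => // z [].
Qed.

Lemma coheir_eqtp (I D : Type) (d : D -> C) (k : M -> D) (b c : I -> C)
    (Uf : set_system (I -> C)) :
  UltraFilter Uf -> d \o k = m ->
  (forall phi, sat phi (tuple_cat b m) -> Uf [set z | sat phi (tuple_cat z m)]) ->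
  realizes Uf d c -> eqtp m b c.
Proof.
move=> UU dk bU cU phi /bU; rewrite -dk.
by apply: (realizes_sub (k := k) _ cU).
Qed.

Lemma eqtp_X x y : eqtp m x y -> X x -> X y.
Proof.
move=> xy Xx; have [sigma [sA _ <-]] := eqtp_automorphism K_big C_hom alpha_small M_small xy.
exact: aut_X.
Qed.

(* Representatives of all the classes are used as parameters: a coheir [c] of
   [tp(b/M)] over them is in relation [U k] with one of them, hence so is every
   other coheir [c'], so that [c] and [c'] are close to each other. By invariance
   a coheir is then close to any realization of [tp(b/M)]. *)
Lemma types_bounded b : X b -> exists k, forall b1 b2,
  eqtp m b b1 -> eqtp m b b2 -> U k b1 b2.
Proof.
move=> Xb; pose Q : Type := quotient X (fsE F).
have Q_small : smT K Q by exact/smallE/F_bounded.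
have /choice[r rP] : forall q : Q, exists r, X r /\ val q = [set y | X y /\ E r y].
  by move=> q; have [r Xr rq] := set_mem (valP q); exists r.
have [Uf [UU UM Ub]] := coheir_ex b.
pose d := tuple_cat m (fun p : Q * alpha => r p.1 p.2).
have d_small : smT K (M + Q * alpha).
  by apply: (smT_sum Kinf) => //; exact: smT_prod.
have [c cU] := realizes_ex K_big C_sat (U := Uf) (d) _ alpha_small d_small.
have mb : eqtp m b c by apply: (coheir_eqtp (k := inl) UU _ Ub cU).
have Xc := eqtp_X mb Xb.
pose q : Q := SigSub (mem_set (imageP (fun x => [set y | X y /\ E x y]) Xc)).
have [Xr rq] := rP q.
have [k Uk] : exists k, U k (r q) c.
  have : val q c by split=> //; exact: fsE_refl.
  by rewrite rq => -[_ /fsEU].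
have dc_small : smT K (M + Q * alpha + alpha) by exact: smT_sum.
have [c' c'U] := realizes_ex K_big C_sat (U := Uf) (tuple_cat d c) _ alpha_small dc_small.
have c'd : realizes Uf d c' by apply: (realizes_sub (k := inl) _ c'U).
(* This automorphism takes [c] to [c'] and fixes every representative, so [c'] is as close to [r q]
   as [c] is. *)
have [sigma [sA sd sc]] := eqtp_automorphism K_big C_hom alpha_small d_small
  (realizes_eqtp UU cU c'd).
have sr : sigma \o r q = r q.
  by apply: funext => i; have /= := congr1 (@^~ (inr (q, i))) sd.
have Uk' : U k (r q) c' by have := aut_U sA Uk; rewrite sr sc.
have Uc := fsU_trans (fsU_sym Uk') Uk.
(* The common coheir [e] over [b1] and [b2] is within [(k + k).+1] of each of them. *)
exists ((k + k).+1 + (k + k).+1).+1 => b1 b2 bb1 bb2.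
have db_small : smT K (M + alpha + alpha).
  by do 2?[apply: (smT_sum Kinf) => //].
have [e eU] := realizes_ex K_big C_sat (U := Uf) (tuple_cat (tuple_cat m b1) b2) _
  alpha_small db_small.
have close b' : realizes Uf (tuple_cat m b') e -> eqtp m b b' -> U (k + k).+1 e b'.
  move=> eU' bb'.
  have cmU : realizes Uf (tuple_cat m c) c'.
    pose f (v : M + alpha) : M + Q * alpha + alpha :=
      match v with inl a => inl (inl a) | inr i => inr i end.
    have -> : tuple_cat m c = tuple_cat d c \o f by apply: funext => -[].
    exact: realizes_sub.
  have [tau [tA _ tc tc']] := coheir_invariant K_big C_hom M_small alpha_small
    alpha_small UU UM (eqtp_trans (eqtp_sym mb) bb') cmU eU'.
  by rewrite -tc -tc'; exact: aut_U.
apply: fsU_trans (fsU_sym (close b1 _ bb1)) (close b2 _ bb2).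
  exact: (realizes_sub (k := inl) _ eU).
pose f (v : M + alpha) : M + alpha + alpha :=
  match v with inl a => inl (inl a) | inr i => inr i end.
have -> : tuple_cat m b2 = tuple_cat (tuple_cat m b1) b2 \o f.
  by apply: funext => -[].
exact: realizes_sub.
Qed.

Lemma eqtp_E x y : X x -> eqtp m x y -> E x y.
Proof.
move=> Xx xy; have [k kP] := types_bounded Xx.
by apply/fsEU; exists k; apply: kP.
Qed.

Variable Gamma : set (beta -> C).
Hypothesis Gamma_group : subgroup_of H (fs_mul F) (fs_one F) inv Gamma.
Hypothesis Gamma_M : forall g, Gamma g -> forall i, M (g i).

Lemma Gamma_H g : Gamma g -> H g.
Proof. exact: subgroup_sub Gamma_group g. Qed.

Lemma translate_formula g (phi : formula L (alpha + M)) : Gamma g ->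
  exists psi : formula L (alpha + M), forall x, X x ->
    sat psi (tuple_cat x m) <-> sat phi (tuple_cat (g ** x) m).
Proof.
move=> Gg; pose k (i : beta) : M := SigSub (mem_set (Gamma_M Gg i)).
have [|psi psiP] := @pullback_translation _ _ _ _ _ F K_big C_sat _ m alpha_small
  M_small k phi.
  exact: Gamma_H.
by exists psi.
Qed.

(* A closed invariant set of types approximated by the [Gamma]-orbit of [a]
   contains a type realized in [G * a]: if [U] is an ultrafilter of elements [h]
   of [Gamma] with [theta (g^-1 * h * a)] for all [g] in [Gamma] and [theta] in
   [Theta], [h1] realizes [U] and [h0] realizes [U] over [h1], then
   [h0^-1 * h1 * a] satisfies [Theta], and it is in [G * a] by shiftiness, as
   [h0] and [h1] have the same type over [M] and [a]. *)
Lemma orbit_meets_closed_invariant a (Theta : set (formula L (alpha + M))) z :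
  shifty F a -> X z ->
  (forall phi, (forall g, Gamma g -> sat phi (tuple_cat (g ** a) m)) ->
     sat phi (tuple_cat z m)) ->
  (forall g theta, Gamma g -> Theta theta -> sat theta (tuple_cat (g ** z) m)) ->
  exists c, E a c /\ forall theta, Theta theta -> sat theta (tuple_cat c m).
Proof.
move=> sh Xz z_cl z_inv; have Xa := sh.1.
have HGamma h : Gamma h -> H h by exact: Gamma_H.
have Ginv g : Gamma g -> Gamma (inv g) by exact: subgroup_inv Gamma_group g.
pose ok (p : (beta -> C) * formula L (alpha + M)) := Gamma p.1 /\ Theta p.2.
pose B (l : seq ((beta -> C) * formula L (alpha + M))) : set (beta -> C) :=
  [set h | Gamma h /\ forall p : (beta -> C) * formula L (alpha + M), List.In p l -> ok p ->
    sat p.2 (tuple_cat (inv p.1 ** h ** a) m)].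
have B0 l : B l !=set0.
  (* Finitely many conditions on translates pull back to one formula [psi] true of [z]. As [z] is in
     the closure of the orbit of [a], some point of the orbit satisfies it. *)
  have [psi [zpsi psiP]] : exists psi : formula L (alpha + M),
      sat psi (tuple_cat z m) /\ forall x, X x -> sat psi (tuple_cat x m) ->
      forall p : (beta -> C) * formula L (alpha + M), List.In p l -> ok p ->
      sat p.2 (tuple_cat (inv p.1 ** x) m).
    elim: l => [|p l [psi [zpsi psiP]]]; first by exists (Not Bot); split=> // x _ _ p [].
    have [[Gp Tp]|nok] := pselect (ok p); last first.
      exists psi; split=> // x Xx /(psiP x Xx) xl q.
      by move=> [<-//|]; exact: xl.
    have [chi chiP] := translate_formula p.2 (Ginv _ Gp).
    exists (And psi chi); rewrite sat_And; split.
      by split=> //; apply/chiP => //; apply: z_inv => //; exact: Ginv.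
    move=> x Xx; rewrite sat_And => -[/(psiP x Xx) xl /chiP-/(_ Xx) xp] q.
    by move=> [<-//|]; exact: xl.
  apply: contrapT => n; have := z_cl (Not psi); rewrite sat_Not; apply=> // g Gg.
  rewrite sat_Not => gpsi; apply: n; exists g; split=> //.
  by apply: psiP => //; apply: actX => //; exact: HGamma.
have BF : ProperFilter (filter_from setT B).
  apply: filter_from_proper => //; apply: filter_from_filter; first by exists [::].
  move=> l l' _ _; exists (l ++ l') => // h [Gh hl].
  by split; split=> // p pl; apply: hl; apply: List.in_or_app; [left|right].
have [Uf [UU sU]] := ultraFilterLemma BF.
have UGamma : Uf Gamma by apply: sU; exists [::] => // h [].
have UB g theta : Gamma g -> Theta theta ->
    Uf [set h | Gamma h /\ sat theta (tuple_cat (inv g ** h ** a) m)].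
  move=> Gg Tt; apply: sU; exists [:: (g, theta)] => // h [Gh hl].
  by split=> //; exact: (hl _ (or_introl erefl)).
have ma_small : smT K (M + alpha) by exact: smT_sum.
have [h1 h1U] := realizes_ex K_big C_sat (U := Uf) (tuple_cat m a) _ beta_small ma_small.
pose d := tuple_cat (tuple_cat m a) (h1 ** a).
have d_small : smT K (M + alpha + alpha) by exact: smT_sum.
have [h0 h0U] := realizes_ex K_big C_sat (U := Uf) (d) _ beta_small d_small.
have h0U' : realizes Uf (tuple_cat m a) h0 by exact: (realizes_sub (k := inl) _ h0U).
have realH D (e : D -> C) h : realizes Uf e h -> H h.
  move=> hU; have [p pP] := fsH_tdef F; apply/pP => phi pphi.
  rewrite -[h]/(tuple_cat h e \o inl) -sat_rename; apply: hU.
  apply: filterS UGamma => g Gg /=; rewrite sat_rename.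
  by move/HGamma/pP: Gg => /(_ phi pphi).
have H1 := realH _ _ _ h1U; have H0 := realH _ _ _ h0U.
have [sigma [sA sma sh01]] := eqtp_automorphism K_big C_hom beta_small ma_small
  (realizes_eqtp UU h0U' h1U).
have [sm sa] : sigma \o m = m /\ sigma \o a = a.
  by move: sma; rewrite comp_tuple_cat => /tuple_cat_inj.
have close x : X x -> E x (sigma \o x).
  by move=> Xx; apply: eqtp_E => //; exact: automorphism_eqtp.
exists (inv h0 ** h1 ** a); split.
  apply: shifty_quotient => //.
    have -> : h1 ** a = sigma \o (h0 ** a) by rewrite aut_act // sh01 sa.
    by apply: close; exact: actX.
  have -> : inv h1 ** a = sigma \o (inv h0 ** a) by rewrite aut_actV // sh01 sa.
  by apply: close; apply: actX => //; exact: fsHV.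
move=> theta Tt.
have Xh1a : X (h1 ** a) by exact: actX.
pose f (v : alpha + M) : alpha + (M + alpha + alpha) :=
  match v with inl i => inl i | inr e => inr (inl (inl e)) end.
have fE x : tuple_cat x d \o f = tuple_cat x m by apply: funext => -[].
have [chi chiP] := @pullback_inverse_orbit_map _ _ _ _ _ F K_big C_sat _ d
  alpha_small beta_small d_small inr (rename f theta) Xh1a.
have chiE h : H h -> sat chi (tuple_cat h d) <->
    sat theta (tuple_cat (inv h ** h1 ** a) m).
  by move=> Hh; rewrite chiP // sat_rename fE.
(* The condition on [h0] is tested on elements [g] of [Gamma]; with [g] fixed it becomes a condition
   on [h1], which is in turn tested on elements of [Gamma], where [UB] provides it. *)
apply/chiE => //; apply: h0U; apply: filterS UGamma => g Gg /=.
apply/chiE; first exact: HGamma.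
have [theta' theta'P] := translate_formula theta (Ginv _ Gg).
pose f1 (v : alpha + M) : alpha + (M + alpha) :=
  match v with inl i => inl i | inr e => inr (inl e) end.
have f1E x : tuple_cat x (tuple_cat m a) \o f1 = tuple_cat x m.
  by apply: funext => -[].
have [rho rhoP] := @pullback_orbit_map _ _ _ _ _ F K_big C_sat _ (tuple_cat m a)
  alpha_small beta_small ma_small inr (rename f1 theta') Xa.
have rhoE h : H h -> sat rho (tuple_cat h (tuple_cat m a)) <->
    sat theta (tuple_cat (inv g ** h ** a) m).
  by move=> Hh; rewrite rhoP // sat_rename f1E theta'P //; exact: actX.
apply/rhoE => //; apply: h1U; apply: filterS (UB g theta Gg Tt) => h [Gh hg] /=.
by apply/rhoE => //; exact: HGamma.
Qed.

End Bounded.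

(** * Almost periodic types *)

Section Flow.
Variables (K : Type) (L : language) (C : structure L) (alpha beta : Type).
Variable F : Fsigma_action K C alpha beta.
Hypothesis K_big : small K [set: set (nat + fun_sym L + rel_sym L)].
Hypothesis C_sat : saturated K C.
Hypothesis C_hom : homogeneous K C.
Hypothesis (alpha_small : smT K alpha) (beta_small : smT K beta).
Hypothesis F_bounded : fs_bounded F.
Variable M : set C.
Hypothesis (M_small : smT K M) (M0 : M !=set0) (M_witnessed : witnessed M).

Local Notation G := (fsG F).
Local Notation H := (fsH F).
Local Notation V := (fsV F).
Local Notation X := (fsX F).
Local Notation "g ** x" := (fs_act F g x) (at level 36, right associativity).
Local Notation inv := (fs_inv F).
Local Notation U n x y := (fsU F n (x, y)).
Local Notation E x y := (fsE F (x, y)).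
Local Notation m := (fun e : M => val e).

Variable Gamma : set (beta -> C).
Hypothesis Gamma_group : subgroup_of H (fs_mul F) (fs_one F) inv Gamma.
Hypothesis Gamma_G : Gamma `<=` G.
Hypothesis Gamma_M : forall g, Gamma g -> forall i, M (g i).

Variable a : alpha -> C.
Hypothesis a_shifty : shifty F a.

Let Gamma_H g : Gamma g -> H g := @Gamma_H _ _ _ _ _ F _ Gamma_group g.
Let Gamma_1 : Gamma (fs_one F) := subgroup_one Gamma_group.
Let Gamma_mul g h : Gamma g -> Gamma h -> Gamma (fs_mul F g h) :=
  @subgroup_mul _ _ _ _ _ _ Gamma_group g h.
Let Xa : X a := a_shifty.1.
Let tr g phi := @translate_formula _ _ _ _ _ F K_big C_sat alpha_small M M_small
  Gamma Gamma_group Gamma_M g phi.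

(* The theory of the closure of the orbit [Gamma * a] in the space of types. *)
Let Theta0 : set (formula L (alpha + M)) :=
  [set phi | forall g, Gamma g -> sat phi (tuple_cat (g ** a) m)].
(* The closed subset of this closure cut out by [Theta]; a maximal good [Theta]
   cuts out a minimal invariant one. *)
Let Z (Theta : set (formula L (alpha + M))) : set (alpha -> C) :=
  [set x : alpha -> C | forall phi, (Theta `|` Theta0) phi -> sat phi (tuple_cat x m)].

(** The formulas defining [X] hold along the orbit of [a], so they belong to [Theta0]. *)
Let Z_X Theta x : Z Theta x -> X x.
Proof.
have [p pP] := fsX_tdef F; move=> Zx; apply/pP => phi pphi.
rewrite -[x]/(tuple_cat x m \o inl) -sat_rename; apply: Zx; right => g Gg.
rewrite sat_rename -[_ \o _]/(g ** a).
by move: phi pphi; apply/pP; apply: actX => //; exact: Gamma_H.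
Qed.

Let good Theta : Prop :=
  Z Theta !=set0 /\ forall g x, Gamma g -> Z Theta x -> Z Theta (g ** x).

Let Theta0_invariant g x phi : Gamma g ->
  (forall phi, Theta0 phi -> sat phi (tuple_cat x m)) -> Theta0 phi ->
  sat phi (tuple_cat (g ** x) m).
Proof.
move=> Gg Zx T0phi; have Xx : X x by apply: (@Z_X set0) => psi [//|]; exact: Zx.
have [psi psiP] := tr phi Gg; apply/psiP => //; apply: Zx => h Gh.
have Xha : X (h ** a) by apply: actX => //; exact: Gamma_H.
apply/psiP => //; rewrite -actM //; try exact: Gamma_H.
by apply: T0phi; exact: Gamma_mul.
Qed.

Let good0 : good set0.
Proof.
split; last first.
  move=> g x Gg Zx phi [//|T0phi]; apply: Theta0_invariant => // psi T0psi.
  by apply: Zx; right.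
by exists a => phi [//|/(_ _ Gamma_1)]; rewrite act1.
Qed.

(** If no finitely many translates of [phi] covered [Z Theta], requiring [Not phi] of all translates
    would define a smaller nonempty invariant set, missing [b] and contradicting maximality of
    [Theta]. *)
Lemma almost_periodic : exists b, E a b /\
  forall phi, sat phi (tuple_cat b m) ->
    exists l : seq (beta -> C), (forall f, List.In f l -> Gamma f) /\
      forall g, Gamma g -> exists2 f, List.In f l &
        sat phi (tuple_cat (f ** g ** b) m).
Proof.
have [S Sgood Stot|Theta [[[z Zz] Theta_inv] Theta_max]] := @Zorn_bigcup _ good.
  split; last first.
    move=> g x Gg Zx phi [[Theta STheta Tphi]|T0phi].
      apply: (Sgood _ STheta).2 => //; last by left.
      by move=> psi [Tpsi|T0psi]; apply: Zx; [left; exists Theta|right].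
    by apply: Theta0_invariant => // psi T0psi; apply: Zx; right.
  have [l lp|x xP] := @saturated_tuple _ _ _ K_big C_sat _ _ m
      ((\bigcup_(Theta in S) Theta) `|` Theta0) alpha_small M_small; last first.
    by exists x.
  (* A finite list involves one member of the chain, or none, in which case [good0] replaces it. *)
  have [Theta [[STheta|->] lTheta]] : exists Theta, (S Theta \/ Theta = set0) /\
      forall phi, phi \in l -> (Theta `|` Theta0) phi.
    elim: l lp => [|phi l IH] lp; first by exists set0; split=> //; right.
    have [psi psil|Theta [ST lT]] := IH; first by apply: lp; rewrite inE psil orbT.
    have [[Theta' ST' phiT']|T0phi] := lp phi (mem_head _ _); last first.
      exists Theta; split=> // psi; rewrite inE => /predU1P[->|/lT//]; by right.
    have [sub|sub] : Theta `<=` Theta' \/ Theta' `<=` Theta.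
      by case: ST => [ST|->]; [exact: Stot|left].
    + exists Theta'; split; first by left.
      move=> psi; rewrite inE => /predU1P[->|/lT[/sub ?|?]]; [left|left|right] => //.
    + exists Theta; split=> // psi; rewrite inE => /predU1P[->|/lT//].
      by left; exact: sub.
  + have [[x Zx] _] := Sgood _ STheta.
    by exists x; apply/sat_ands => phi /lTheta/Zx.
  + have [[x Zx] _] := good0.
    by exists x; apply/sat_ands => phi /lTheta/Zx.
have [|||b [Eab bP]] := @orbit_meets_closed_invariant _ _ _ _ _ F K_big C_sat C_hom
    alpha_small beta_small F_bounded M M_small M0 M_witnessed Gamma Gamma_group
    Gamma_M a (Theta `|` Theta0) z a_shifty.
- exact: Z_X Zz.
- by move=> phi T0phi; apply: Zz; right.
- by move=> g theta Gg; exact: Theta_inv.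
have Zb : Z Theta b by move=> phi; exact: bP.
exists b; split=> // phi bphi.
suff [l [lG lP]] : exists l : seq (beta -> C), (forall f, List.In f l -> Gamma f) /\
    forall x, Z Theta x -> exists2 f, List.In f l & sat phi (tuple_cat (f ** x) m).
  by exists l; split=> // g Gg; apply: lP; exact: Theta_inv.
apply: contrapT => nl.
(* All pullbacks of [Not phi] along [Gamma], taken up to equivalence on [X]. *)
pose Psi : set (formula L (alpha + M)) := [set psi | exists2 g, Gamma g &
  forall x, X x -> sat psi (tuple_cat x m) <-> sat (Not phi) (tuple_cat (g ** x) m)].
apply: (Theta_max (Theta `|` Psi)).
  split; first by move=> psi; left.
  move=> sub; have [psi psiP] := tr (Not phi) Gamma_1.
  have /sub Tpsi : (Theta `|` Psi) psi by right; exists (fs_one F).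
  have Xb : X b by exact: Z_X Zb.
  have := Zb psi (or_introl Tpsi); rewrite psiP // act1 //.
  by move=> h; apply: h.
have ZW x : Z (Theta `|` Psi) x -> Z Theta x.
  by move=> Zx psi [Tpsi|T0psi]; apply: Zx; [left; left|right].
split; last first.
  move=> g x Gg Zx psi [[Tpsi|[h Gh hP]]|T0psi].
  - by apply: (Theta_inv g) => //; [exact: ZW|left].
  - have Xx := Z_X Zx; rewrite hP; last by apply: actX => //; exact: Gamma_H.
    have Ghg := Gamma_mul Gh Gg; have [chi chiP] := tr (Not phi) Ghg.
    rewrite -actM //; try exact: Gamma_H.
    by rewrite -chiP //; apply: Zx; left; right; exists (fs_mul F h g).
  - by apply: (Theta_inv g) => //; [exact: ZW|right].
have [q qp|x xP] := @saturated_tuple _ _ _ K_big C_sat _ _ m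
    ((Theta `|` Psi) `|` Theta0) alpha_small M_small; last by exists x.
(* A finite part of [Psi] forbids [phi] on finitely many translates only, and [nl] provides a point
   of [Z Theta] satisfying these restrictions. *)
have [l [lG lq]] : exists l : seq (beta -> C), (forall f, List.In f l -> Gamma f) /\
    forall x, Z Theta x -> (forall f, List.In f l -> sat (Not phi) (tuple_cat (f ** x) m)) ->
    forall psi, psi \in q -> sat psi (tuple_cat x m).
  elim: q qp => [|psi q IH] qp; first by exists nil; split.
  have [chi chiq|l [lG lP]] := IH; first by apply: qp; rewrite inE chiq orbT.
  have [[Tpsi|[g Gg gP]]|T0psi] := qp psi (mem_head _ _).
  - exists l; split=> // x Zx xl chi; rewrite inE => /predU1P[->|]; last exact: lP.
    by apply: Zx; left.
  - exists (g :: l); split=> [f [<-//|]|]; first exact: lG.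
    move=> x Zx xl chi; rewrite inE => /predU1P[->|].
      by apply/gP; [exact: Z_X Zx|apply: xl; left].
    by apply: lP => // f fl; apply: xl; right.
  - exists l; split=> // x Zx xl chi; rewrite inE => /predU1P[->|]; last exact: lP.
    by apply: Zx; right.
apply: contrapT => nq; apply: nl; exists l; split=> // x Zx; apply: contrapT => nx.
apply: nq; exists x; apply/sat_ands; apply: lq => // f fl; rewrite sat_Not => fx.
by apply: nx; exists f.
Qed.

Hypothesis Gamma_unbounded : forall n, exists2 g, Gamma g & ~ U n (g ** a) a.

Let V_bound (l : seq (beta -> C)) : (forall f, List.In f l -> Gamma f) ->
  exists n, forall f, List.In f l -> V n f.
Proof.
elim: l => [|f l IH] lG; first by exists 0.
have [f' f'l|n nP] := IH; first by apply: lG; right.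
have [k Vf] := fsGV (Gamma_G (lG f (or_introl erefl))).
exists (n + k) => f' [<-|/nP Vf'].
  exact: fsV_le (leq_addl _ _) Vf.
exact: fsV_le (leq_addr _ _) Vf'.
Qed.

(** An element [g] moving [a] farther than [(k + n).+1] still moves it farther than [n] after
    composition with the return element [f], which contributes at most [k]. *)
Lemma recurrence b : E a b ->
  (forall phi, sat phi (tuple_cat b m) ->
    exists l : seq (beta -> C), (forall f, List.In f l -> Gamma f) /\
      forall g, Gamma g -> exists2 f, List.In f l &
        sat phi (tuple_cat (f ** g ** b) m)) ->
  forall phi n, sat phi (tuple_cat b m) ->
    exists g, [/\ Gamma g, sat phi (tuple_cat (g ** b) m) & ~ U n (g ** a) a].
Proof.
move=> [_ /= Xb _] bP phi n bphi.
have [l [lG lP]] := bP phi bphi; have [k kP] := V_bound lG.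
have [g Gg ng] := Gamma_unbounded (k + n).+1; have [f fl fgb] := lP g Gg.
have Hf := Gamma_H (lG f fl); have Hg := Gamma_H Gg.
exists (fs_mul F f g); split; first exact: Gamma_mul (lG f fl) Gg.
  by rewrite actM.
rewrite actM // => Ufg; apply: ng; apply: fsU_trans Ufg.
by apply: fsU_act; [exact: kP|exact: actX].
Qed.

(** The element [g] is replaced by its product with some [h] that keeps [h ** b] in the pullback of
    [phi] by [g] while moving [a] very far. If the new point were close to some [f ** b1], then
    [h ** b2] would be close to [a], and shiftiness would bound the displacement of [a] by [h]. *)
Lemma separation : exists2 b, E a b &
  forall phi g (l : seq (beta -> C)) n, Gamma g -> sat phi (tuple_cat (g ** b) m) ->
    (forall f, List.In f l -> Gamma f) ->
    exists g', [/\ Gamma g', sat phi (tuple_cat (g' ** b) m) &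
      forall f b1 b2, List.In f l -> eqtp m b b1 -> eqtp m b b2 ->
        ~ U n (f ** b1) (g' ** b2)].
Proof.
have [b [Eab bP]] := almost_periodic.
have rec := recurrence Eab bP; exists b => // phi g l n Gg gphi lG.
have Xb : X b by case: Eab.
have [j Uab] := (fsEU F a b).1 Eab.
have [k kP] := types_bounded K_big C_sat C_hom alpha_small F_bounded M_small M0
  M_witnessed Xb.
have ab b' : eqtp m b b' -> U (j + k).+1 a b'.
  by move=> bb'; apply: fsU_trans Uab _; exact: kP.
have [k0 lV] := V_bound lG; have [k1 gV] := fsGV (Gamma_G Gg).
(* Here [t] bounds the path from [a] through [b1] and [f ** b1] to [g ** h ** b2], and [s] adds the
   cost of removing [g]. The last summand of [s] ensures that [V s] contains an element carrying [a]
   to [b2]. *)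
pose t := (((j + k).+1 + k0).+1 + n).+1.
pose s := (k1 + t).+1 + (j + k).+1.
(* Two inversions are made: the first leads from [h ** b2] to [inv h ** a], the second back to
   [h ** a]. *)
have [s' s'P] := shifty_norm a_shifty s.
have [s'' s''P] := shifty_norm a_shifty s'.
have [psi psiP] := tr phi Gg.
have [|h [Gh hpsi nh]] := rec psi s''; first by apply/psiP.
have Hh := Gamma_H Gh; have Hg := Gamma_H Gg.
have Xhb : X (h ** b) by exact: actX.
exists (fs_mul F g h); split; first exact: Gamma_mul.
  by rewrite actM //; apply/psiP.
move=> f b1 b2 fl /ab Ub1 /ab Ub2.
have [_ Xb1] := fsU_X Ub1; have [_ Xb2] := fsU_X Ub2.
have Xhb2 : X (h ** b2) by exact: actX.
rewrite actM // => Uf; apply: nh.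
have Ut : U t a (g ** h ** b2).
  by apply: fsU_trans Uf; apply: fsU_trans Ub1 _; apply: fsU_act => //; exact: lV.
have Us : U (k1 + t).+1 (h ** b2) a.
  exact: fsU_trans (fsU_act gV Xhb2) (fsU_sym Ut).
have [/= _ _ [v Vv vab]] := Ub2.
have Us' : U s' (inv h ** a) a.
  apply: (s'P h v (Gamma_G Gh)).
    by apply: fsV_le Vv; exact: leq_addl.
  by rewrite vab; apply: fsU_le Us; exact: leq_addr.
have Ghi : G (inv h) by apply/fsGinv/Gamma_G.
have := s''P (inv h) (fs_one F) Ghi (fsV_one F s').
by rewrite act1 // actVV //; exact.
Qed.

End Flow.

(** * The strong Choquet game *)

(** The latest bit comes first, so that [behead] gives the parent of a node. *)
Fixpoint branch (x : nat -> bool) (n : nat) : seq bool :=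
  if n is n'.+1 then x n' :: branch x n' else [::].

Lemma size_branch x n : size (branch x n) = n.
Proof. by elim: n => //= n ->. Qed.

Lemma branch_inj x y n : branch x n = branch y n ->
  forall i, i < n -> x i = y i.
Proof.
elim: n => // n IH /= [xyn /IH e] i; rewrite ltnS leq_eqVlt => /predU1P[->//|].
exact: e.
Qed.

Lemma branch_surj (s : seq bool) : exists x, branch x (size s) = s.
Proof.
elim: s => [|b s [x xs]]; first by exists (fun=> false).
exists (fun i => if i == size s then b else x i) => /=; rewrite eqxx; congr (_ :: _).
rewrite -[RHS]xs.
suff h n : n <= size s ->
    branch (fun i => if i == size s then b else x i) n = branch x n by exact: h.
by elim: n => //= n IH ns; rewrite IH 1?ltnW // ltn_eqF.
Qed.

Section Tree.
Variables (Z : topologicalType) (R : nat -> Z -> Z -> Prop) (P : set Z) (p0 : Z).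
Hypothesis R_sym : forall n x y, R n x y -> R n y x.
Hypothesis R_succ : forall n x y, R n x y -> R n.+1 x y.
Hypothesis R_closed : forall n x y, ~ R n x y -> exists A B : set Z,
  [/\ open A, open B, A x, B y & forall x' y', A x' -> B y' -> ~ R n x' y'].
Hypothesis Pp0 : P p0.
Hypothesis P_separated : forall (W : set Z) p (l : seq Z) n,
  open W -> P p -> W p -> (forall q, List.In q l -> P q) ->
  exists p', [/\ P p', W p' & forall q, List.In q l -> ~ R n q p'].

(** Induction on the list: the new point is moved away from those already chosen by [P_separated],
    and [R_closed] then lets the finitely many open sets shrink until they are pairwise
    separated. *)
Lemma separate_open_sets (I : eqType) (l : seq I) (W : I -> set Z) n : uniq l ->
  (forall i, i \in l -> open (W i) /\ exists2 p, P p & W i p) ->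
  exists (O : I -> set Z) (p : I -> Z),
    (forall i, i \in l -> [/\ open (O i), O i `<=` W i, O i (p i) & P (p i)]) /\
    forall i j, i \in l -> j \in l -> i <> j ->
      forall x y, O i x -> O j y -> ~ R n x y.
Proof.
elim: l => [_ _|i l IH /= /andP[il lu] lW]; first by exists (fun=> setT), (fun=> p0).
have [//|j jl|O [p [lO lR]]] := IH; first by apply: lW; rewrite inE jl orbT.
have [oW [q Pq Wq]] := lW i (mem_head _ _).
have [|p' [Pp' Wp' sep]] := P_separated (l := map p l) n oW Pq Wq.
  move=> _ /List.in_map_iff[j [<- jl]].
  have /lO[//] : j \in l.
  by elim: l jl {IH il lu lW lO lR} => //= k l IH [->|/IH]; rewrite inE ?eqxx // => ->; rewrite orbT.
have /choice[AB ABP] : forall j, exists AB : set Z * set Z, j \in l ->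
    [/\ open AB.1, open AB.2, AB.1 (p j), AB.2 p' &
      forall x y, AB.1 x -> AB.2 y -> ~ R n x y].
  move=> j; have [jl|_] := boolP (j \in l); last by exists (setT, setT).
  have [|A [B h]] := @R_closed n (p j) p'; last by exists (A, B).
  apply: sep; apply: List.in_map.
  by elim: l jl {IH il lu lW lO lR} => //= k l IH; rewrite inE => /predU1P[->|/IH]; [left|right].
have [B [oB Bp' BP]] : exists B : set Z, [/\ open B, B p' &
    forall j, j \in l -> B `<=` (AB j).2].
  elim: {IH il lu lW lO lR sep} l ABP => [|j l IH] ABP.
    by exists setT; split=> //; exact: openT.
  have [k kl|B [oB Bp' BP]] := IH; first by apply: ABP; rewrite inE kl orbT.
  have [_ o2 _ B2 _] := ABP j (mem_head _ _).
  exists (B `&` (AB j).2); split=> //; first exact: openI.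
  move=> k; rewrite inE => /predU1P[->|/BP sB] z [Bz Az] //.
  exact: sB.
have ni j : j \in l -> (j == i) = false.
  by move=> jl; apply: contraNF il => /eqP <-.
exists (fun j => if j == i then W i `&` B else O j `&` (AB j).1),
  (fun j => if j == i then p' else p j); split=> [j|j k].
  rewrite inE => /predU1P[->|jl]; first by rewrite eqxx; split=> //; exact: openI.
  have [oO OW Op Pp] := lO j jl; have [o1 _ A1 _ _] := ABP j jl.
  rewrite ni //; split=> //; first exact: openI.
  by move=> z [/OW].
rewrite !inE => /predU1P[->|jl] /predU1P[->|kl] jk x y //.
- rewrite eqxx ni // => -[_ Bx] [_ Ay] /R_sym.
  by have [_ _ _ _] := ABP k kl; apply=> //; exact: (BP _ kl).
- rewrite eqxx ni // => -[_ Ax] [_ By].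
  by have [_ _ _ _] := ABP j jl; apply=> //; exact: (BP _ jl).
- by rewrite !ni // => -[Ox _] [Oy _]; exact: (lR j k jl kl jk x y Ox Oy).
Qed.

(** Player A moves at all nodes of a level simultaneously, inside the replies at their parents, so
    that the sets at level [n] are pairwise separated for [R n]. Each branch is then a legal play,
    and its point comes from the winning strategy. *)
Lemma choquet_perfect : strong_choquet Z ->
  exists f : (nat -> bool) -> Z, forall x y, x <> y -> forall n, ~ R n (f x) (f y).
Proof.
move=> [tau win].
pose hist := seq (set Z * Z).
pose cur (h : hist) : set Z := if h is [::] then setT else tau h.
pose inv n (A : seq bool -> hist) := forall s, size s = n ->
  open (cur (A s)) /\ exists2 p, P p & cur (A s) p.
pose good n (A : seq bool -> hist) (mv : seq bool -> set Z * Z) :=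
  (forall s, size s = n.+1 -> [/\ open (mv s).1, (mv s).1 `<=` cur (A (behead s)),
    (mv s).1 (mv s).2 & P (mv s).2]) /\
  forall s t, size s = n.+1 -> size t = n.+1 -> s <> t ->
    forall x y, (mv s).1 x -> (mv t).1 y -> ~ R n x y.
have step n A : exists mv, inv n A -> good n A mv.
  have [iA|nA] := pselect (inv n A); last by exists (fun=> (setT, p0)).
  pose l : seq (seq bool) := [seq val t | t : n.+1.-tuple bool].
  have lP s : (s \in l) = (size s == n.+1).
    apply/mapP/eqP => [[t _ ->]|sn]; first exact: size_tuple.
    by exists (Tuple (introT eqP sn)); rewrite ?mem_enum.
  have [||O [p [lO lR]]] := @separate_open_sets _ l (fun s => cur (A (behead s))) n.
  - by rewrite map_inj_uniq ?enum_uniq //; exact: val_inj.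
  - by move=> s; rewrite lP => /eqP sn; apply: iA; rewrite size_behead sn.
  exists (fun s => (O s, p s)) => _; split=> [s sn|s t sn tn].
    by apply: lO; rewrite lP sn.
  by apply: lR; rewrite lP ?sn ?tn.
have /choice[next nextP] : forall nA : nat * (seq bool -> hist), exists mv,
    inv nA.1 nA.2 -> good nA.1 nA.2 mv by move=> nA; exact: step.
(* [level n] sends a node of length [n] to the sequence of moves leading to it. *)
pose level := fix level n : seq bool -> hist := if n is n'.+1 then
  fun s => rcons (level n' (behead s)) (next (n', level n') s) else fun=> [::].
pose move n := next (n, level n).
pose O (x : nat -> bool) n := (move n (branch x n.+1)).1.
pose pt (x : nat -> bool) n := (move n (branch x n.+1)).2.
have histE x n : mkseq (fun i => (O x i, pt x i)) n = level n (branch x n).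
  elim: n => [//|n IH]; rewrite mkseqS IH /=; congr (rcons _ _).
  by rewrite /O /pt -surjective_pairing.
have curE x n : cur (level n.+1 (branch x n.+1)) = choquet_response tau (O x) (pt x) n.
  rewrite /choquet_response histE /cur; case e: (level _ _) => //.
  by move: (congr1 size e); rewrite /= size_rcons.
have legal n : inv n (level n) -> forall x, choquet_legal tau (O x) (pt x) n.
  move=> /(nextP (n, level n))[mvP _] x.
  have [o1 sub pin _] := mvP (branch x n.+1) (size_branch _ _).
  split=> //; apply: (subset_trans sub) => /=.
  by case: n {mvP o1 sub pin} => // n; rewrite curE.
(* Replies of the strategy are controlled only after legal moves, so the invariant at all earlier
   levels is needed: hence strong induction. *)
have invP n : inv n (level n).
  elim/ltn_ind: n => -[_ s _|n IH].
    by split; [exact: openT|exists p0].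
  move=> s sn; have [x xs] := branch_surj s; rewrite sn in xs; rewrite -xs curE.
  have [|oR RO Rp] := (win (O x) (pt x)).1 n.
    by move=> i ni; apply: legal; exact: IH.
  split=> //; exists (pt x n) => //.
  have [mvP _] := nextP (n, level n) (IH n (ltnSn n)).
  by have [_ _ _] := mvP (branch x n.+1) (size_branch _ _).
have /choice[f fP] : forall x, exists z, forall n, O x n z.
  move=> x; have [|z zP] := (win (O x) (pt x)).2.
    by move=> n; exact: legal.
  exists z => n; have [|_ RO _] := (win (O x) (pt x)).1 n.
    by move=> i _; exact: legal.
  by apply: RO; exact: zP.
exists f => x y xy n.
have [k xyk] : exists k, x k <> y k.
  by apply/existsNP => e; apply: xy; apply: funext.
(* From the first level that records bit [k] on, the two branches pass through distinct nodes;
   smaller indices are reached by monotonicity of [R]. *)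
have far i : k <= i -> ~ R i (f x) (f y).
  move=> ki; have [_ sep] := nextP (i, level i) (invP i).
  apply: (sep (branch x i.+1) (branch y i.+1)); rewrite ?size_branch //; try exact: fP.
  by move/branch_inj => /(_ k); rewrite ltnS => /(_ ki).
have [nk|kn] := leqP n k; last by apply: far; exact: ltnW.
move=> Rn; apply: (far k (leqnn k)).
by rewrite -(subnK nk); elim: (k - n) => [//|i IH]; rewrite addSn; exact: R_succ.
Qed.

End Tree.

(** * The theorem *)

Section Subgroup.
Variables (S : Type) (H : set S) (mul : S -> S -> S) (one : S) (inv : S -> S).
Hypothesis H_group : group_on H mul one inv.

Lemma group_inv_eq x y : H x -> H y -> mul x y = one -> inv x = y.
Proof.
move=> Hx Hy xy; have Hix := group_inv H_group Hx.
by rewrite -(group_mulg1 H_group Hix) -xy (group_mulA H_group) //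
  (group_mulVg H_group) // (group_mul1g H_group).
Qed.

Variable g : nat -> S.

Definition letter (p : nat * bool) : S := if p.2 then g p.1 else inv (g p.1).

Definition word (s : seq (nat * bool)) : S :=
  foldr (fun p x => mul (letter p) x) one s.

Lemma range_word_subgroup (G : set S) : subgroup_of H mul one inv G ->
  (forall n, G (g n)) ->
  subgroup_of H mul one inv (range word) /\ range word `<=` G.
Proof.
move=> G_sub Gg.
have Gl p : G (letter p).
  by rewrite /letter; case: p.2 => //; exact: subgroup_inv G_sub _ _.
have Gw s : G (word s).
  elim: s => [|p s IH] /=; first exact: subgroup_one G_sub.
  exact: subgroup_mul G_sub _ _ _ _.
have GH x : G x -> H x by exact: subgroup_sub G_sub x.
have catE s t : word (s ++ t) = mul (word s) (word t).
  elim: s => [|p s IH] /=; first by rewrite (group_mul1g H_group) //; exact: GH.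
  by rewrite IH (group_mulA H_group) //; exact: GH.
split; last by move=> _ [s _ <-].
split.
- by move=> _ [s _ <-]; exact: GH.
- by exists [::].
- by move=> _ _ [s _ <-] [t _ <-]; exists (s ++ t).
move=> _ [s _ <-]; elim: s => [|p s [t _ ts]].
  exists [::] => //=; apply/esym/group_inv_eq; try exact: group_one H_group.
  exact: group_mul1g H_group _ (group_one H_group).
have lw q : word [:: q] = letter q by rewrite /= (group_mulg1 H_group) //; exact: GH.
have Hl q : H (letter q) by exact: GH.
have Hg n : H (g n) by exact: GH.
have lK : mul (letter p) (letter (p.1, ~~ p.2)) = one.
  case: p => n [] /=; rewrite /letter /=.
    exact: group_mulgV H_group _ _.
  exact: group_mulVg H_group _ _.
have Hw u : H (word u) by exact: GH.
(* The inverse of a word is the inverse of its tail followed by the inverse of its first letter. *)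
exists (t ++ [:: (p.1, ~~ p.2)]) => //; rewrite catE lw; apply/esym/group_inv_eq.
- exact: Hw.
- exact: group_mul H_group _ _ _ _.
rewrite -[word (p :: s)]/(mul (letter p) (word s)).
rewrite -(group_mulA H_group) //; last exact: group_mul H_group _ _ _ _.
rewrite (group_mulA H_group (Hw s)) // ts (group_mulgV H_group) //.
by rewrite (group_mul1g H_group).
Qed.

End Subgroup.

(** * Open sets in the space of types of elements of [Y] *)

Section TypeSpace.
Variables (L : language) (C : structure L) (I : Type) (M : set C) (Y : set (I -> C)).

Lemma types_of_open_basic (phi : formula L (I + M)) :
  open [set z : set_type (types_of M Y) | stone_set (val z) phi].
Proof.
exists (stone_basic phi) => //; exists [set phi] => //.
by rewrite bigcup_set1.
Qed.

Lemma types_of_open_nbhd (W : set (set_type (types_of M Y))) z : open W -> W z ->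
  exists2 phi, stone_set (val z) phi & forall z' : set_type (types_of M Y),
    stone_set (val z') phi -> W z'.
Proof.
move=> [O [D _ <-] <-] [phi Dphi zphi]; exists phi => // z' z'phi.
by exists phi.
Qed.

End TypeSpace.

(** * Closedness of the relations [fsU F n] on types *)

Section Separation.
Variables (K : Type) (L : language) (C : structure L) (alpha beta : Type).
Variable F : Fsigma_action K C alpha beta.
Hypothesis K_big : small K [set: set (nat + fun_sym L + rel_sym L)].
Hypothesis C_sat : saturated K C.
Hypothesis (alpha_small : smT K alpha) (beta_small : smT K beta).
Variable M : set C.
Hypothesis M_small : smT K M.

Let Kinf := monster_infinite K_big.
Local Notation m := (fun e : M => val e).

(** If no two formulas separated the types, compactness would give realizations of both together
    with an element of [fsV F n] carrying one to the other, as [fsV F n] and the graph of the action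
    are type-definable. *)
Lemma fsU_separated n (x0 y0 : alpha -> C) :
  (forall x y, eqtp m x0 x -> eqtp m y0 y -> ~ fsU F n (x, y)) ->
  exists phi psi : formula L (alpha + M), [/\ sat_over phi x0, sat_over psi y0 &
    forall x y, sat_over phi x -> sat_over psi y -> ~ fsU F n (x, y)].
Proof.
move=> nU; apply: contrapT => nsep.
pose J := {p : formula L (alpha + M) * formula L (alpha + M) |
  sat_over p.1 x0 /\ sat_over p.2 y0}.
pose T : Type := (beta + (alpha + alpha))%type.
pose fst_ (v : T -> C) : alpha -> C := v \o inr \o inl.
pose snd_ (v : T -> C) : alpha -> C := v \o inr \o inr.
pose B (p : J) : set (T -> C) := [set v : T -> C | [/\ sat_over (sval p).1 (fst_ v),
  sat_over (sval p).2 (snd_ v), fsV F n (v \o inl) &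
  act_graph F (tuple_cat (tuple_cat (v \o inl) (fst_ v)) (snd_ v))]].
pose j p q (xp : sat_over p x0) (yq : sat_over q y0) : J := exist _ (p, q) (conj xp yq).
pose top : formula L (alpha + M) := Not Bot.
have top_sat x : sat_over top x by exact: id.
have [||p|v vP] := @saturated_directed K L C K_big C_sat T M J m B (j _ _ (top_sat x0) (top_sat y0))
    _ M_small.
- by do 2?[apply: (smT_sum Kinf) => //].
- move=> [[p p'] [/= px py]] [[q q'] [/= qx qy]].
  have x_pq : sat_over (And p q) x0 by rewrite /sat_over sat_And.
  have y_pq : sat_over (And p' q') y0 by rewrite /sat_over sat_And.
  exists (j _ _ x_pq y_pq) => v [/=].
  by rewrite /sat_over !sat_And => -[? ?] [? ?] Vv Av; split; split.
- apply: contrapT => Bn; apply: nsep; have [px py] := svalP p.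
  exists (sval p).1, (sval p).2; split=> // x y xp yp [/= Xx Xy [h Vh hx]].
  apply: Bn; exists (tuple_cat h (tuple_cat x y)); split=> //.
  by apply/act_graphE; split=> //; exact: fsVH Vh.
have rP W (r : W -> T) (chi : formula L W) :
    (forall v' p, B p v' -> sat chi (v' \o r)) -> sat chi (v \o r).
  move=> h; have := vP (j _ _ (top_sat x0) (top_sat y0)) (rename (inl \o r) chi).
  by rewrite sat_rename; apply=> v' /h; rewrite sat_rename.
have Vv : fsV F n (v \o inl).
  have [p pP] := fsV_tdef F n; apply/pP => chi pchi; apply: rP => v' q [_ _ Vv' _].
  by move/pP: Vv' => /(_ chi pchi).
have Av : act_graph F (tuple_cat (tuple_cat (v \o inl) (fst_ v)) (snd_ v)).
  pose r (u : beta + alpha + alpha) : T := match u with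
    | inl (inl i) => inl i | inl (inr i) => inr (inl i) | inr i => inr (inr i) end.
  have rE v' : tuple_cat (tuple_cat (v' \o inl) (fst_ v')) (snd_ v') = v' \o r.
    by apply: funext => -[[]|].
  have [p pP] := act_graph_tdef F; rewrite rE; apply/pP => chi pchi.
  by apply: rP => v' q [_ _ _]; rewrite rE => /pP/(_ chi pchi).
have /act_graphE[Hv Xv ve] := Av.
have projP (k : alpha -> T) (chi : formula L (alpha + M)) (p : J) :
    (forall v', B p v' -> sat_over chi (v' \o k)) -> sat_over chi (v \o k).
  pose r (u : alpha + M) : T + M := match u with inl i => inl (k i) | inr e => inr e end.
  have rE v' : tuple_cat v' m \o r = tuple_cat (v' \o k) m by apply: funext => -[].
  move=> h; rewrite /sat_over -rE -sat_rename; apply: (vP p) => v' /h.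
  by rewrite sat_rename rE.
apply: (nU (fst_ v) (snd_ v)).
- by move=> chi xchi; apply: (projP (inr \o inl) chi (j chi _ xchi (top_sat y0))) => v' [].
- by move=> chi ychi; apply: (projP (inr \o inr) chi (j _ chi (top_sat x0) ychi)) => v' [].
- split=> //=; last by exists (v \o inl).
  by rewrite -ve; exact: actX.
Qed.

End Separation.

Theorem theorem3p36 (K : Type) (L : language) (T : set (sentence L))
    (T_complete : complete_theory T)
    (C : structure L) (C_monster : monster K T C)
    (alpha beta : Type)
    (alpha_small : small K [set: alpha]) (beta_small : small K [set: beta])
    (F : Fsigma_action K C alpha beta) (F_bounded : fs_bounded F)
    (Y : set (alpha -> C)) (Y_choquet : pseudo_strong_choquet K Y)
    (YX : Y `<=` fsX F) (Y_invariant : invariant_under (fsE F) Y)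
    (a : alpha -> C) (Ya : Y a) (a_shifty : shifty F a)
    (a_not_closed : ~ strongly_closed_on F (fs_orbit F a)) :
  [set: set nat] #<= quotient Y (fsE F).
Proof.
have [_ K_big C_sat C_hom] := C_monster.
have Kinf := monster_infinite K_big.
have /small_typeE sa := alpha_small; have /small_typeE sb := beta_small.
(* If all of [fsG F] moved [a] within [n], any two points of the orbit would be within [(n + n).+1],
   making the relation strongly closed there. *)
have /choice[g gP] : forall n, exists g, fsG F g /\ ~ fsU F n (fs_act F g a, a).
  move=> n; apply: contrapT => /forallNP h; apply: a_not_closed.
  have aU g : fsG F g -> fsU F n (fs_act F g a, a).
    by move=> Gg; apply: contrapT => ng; apply: (h g).
  exists (n + n).+1; apply/seteqP; split=> -[x y] [+ [Dx Dy]]; split=> //.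
    case: Dx => /= g Gg <-; case: Dy => /= g' Gg' <-.
    exact: fsU_trans (aU _ Gg) (fsU_sym (aU _ Gg')).
  by apply/fsEU; exists (n + n).+1.
have Gg n := (gP n).1.
pose w := word (fs_mul F) (fs_one F) (fs_inv F) g.
have [Gamma_group Gamma_G] := range_word_subgroup (fsH_group F) (fsG_subgroup F) Gg.
(* The generators of the model are all the coordinates of all the words. *)
have [M [M_model M0 M_wit wM]] := small_model_containing
  (fun p : seq (nat * bool) * beta => w p.1 p.2) K_big
  (smT_prod Kinf (@smT_countable K Kinf _) sb).
have M_small : smT K M by case: M_model => /smallE.
have Gamma_M h : range w h -> forall i, M (h i).
  by move=> [s _ <-] i; exact: (wM (s, i)).
have Gamma_unb n : exists2 h, range w h & ~ fsU F n (fs_act F h a, a).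
  exists (g n); last exact: (gP n).2.
  exists [:: (n, true)] => //=; apply: group_mulg1 (fsH_group F) _ _.
  exact: (fsGH (Gg n)).
have [b Eab sep] := separation K_big C_sat C_hom sa sb F_bounded M_small M0 M_wit
  Gamma_group Gamma_G Gamma_M a_shifty Gamma_unb.
have Yb : Y b := Y_invariant _ _ Eab Ya.
have Xb := YX _ Yb.
have Ygb h : range w h -> Y (fs_act F h b).
  by move=> /Gamma_G Gh; apply: Y_invariant Yb; exact: fsE_act.
pose Z : topologicalType := set_type (types_of M Y).
have tpZ y (Yy : Y y) : tp M y \in types_of M Y by apply/mem_set; exists y.
pose pt h (Gh : range w h) : Z := SigSub (tpZ _ (Ygb h Gh)).
have G1 : range w (fs_one F) := subgroup_one Gamma_group.
(* Types are related as soon as some pair of their realizations is; non-related types therefore have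
   no realizations within [n] of each other. *)
pose R n (z z' : Z) := exists x y, [/\ forall phi, stone_set (val z) phi -> sat_over phi x,
  forall phi, stone_set (val z') phi -> sat_over phi y & fsU F n (x, y)].
pose P : set Z := [set z | exists2 h, range w h & val z = tp M (fs_act F h b)].
have [f fP] : exists f : (nat -> bool) -> Z, forall x y, x <> y ->
    forall n, ~ R n (f x) (f y).
  apply: (@choquet_perfect Z R P (pt _ G1)); last exact: Y_choquet.
  - by move=> n z z' [x [y [zx zy xy]]]; exists y, x; split=> //; exact: fsU_sym.
  - move=> n z z' [x [y [zx zy xy]]]; exists x, y; split=> //.
    exact: fsU_le (leqnSn n) xy.
  - move=> n z z' nR; have [x0 Yx0 zE] := set_mem (valP z).
    have [y0 Yy0 z'E] := set_mem (valP z').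
    have [phi [psi [phiz psiz' sp]]] : exists phi psi, [/\ stone_set (val z) phi,
        stone_set (val z') psi & forall x y, sat_over phi x -> sat_over psi y ->
        ~ fsU F n (x, y)].
      rewrite -zE -z'E; apply: (fsU_separated K_big C_sat sa sb M_small) => x y zx z'y xy.
      by apply: nR; exists x, y; rewrite -zE -z'E.
    exists [set z : Z | stone_set (val z) phi], [set z : Z | stone_set (val z) psi].
    split=> //; try exact: types_of_open_basic.
    move=> z1 z2 zphi zpsi [x [y [z1x z2y]]].
    by apply: sp; [exact: z1x|exact: z2y].
  - by exists (fs_one F).
  - move=> W p l n oW [h Gh pE] Wp lP.
    have [phi phip phiW] := types_of_open_nbhd oW Wp.
    have [l' [l'G l'P]] : exists l' : seq (beta -> C),
        (forall h, List.In h l' -> range w h) /\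
        forall q, List.In q l -> exists2 h, List.In h l' & val q = tp M (fs_act F h b).
      elim: l lP => [|q l IH] lP; first by exists nil.
      have [q' q'l|l' [l'G l'P]] := IH; first by apply: lP; right.
      have [h' Gh' qE] := lP q (or_introl erefl).
      exists (h' :: l'); split=> [h1 [<-//|]|q1 [<-|]]; first exact: l'G.
        by exists h' => //; left.
      by move=> /l'P[h1 h1l q1E]; exists h1 => //; right.
    have [|h' [Gh' h'phi h'sep]] := sep phi h l' n Gh _ l'G.
      by move: phip; rewrite pE.
    exists (pt h' Gh'); split; [by exists h'|exact: phiW|].
    move=> q /l'P[h1 h1l qE] [x [y [qx py xy]]].
    (* Automorphisms fixing [M] fix [k], so every realization of the type of a translate is the
       translate of a realization of the type of [b]. *)
    have lift k u : range w k -> eqtp (fun e : M => val e) (fs_act F k b) u ->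
        exists2 b', eqtp (fun e : M => val e) b b' & u = fs_act F k b'.
      move=> Gk ku.
      have Hk : fsH F k by exact/fsGH/Gamma_G.
      have [sigma [sA sm sk]] := eqtp_automorphism K_big C_hom sa M_small ku.
      exists (sigma \o b); first exact: automorphism_eqtp.
      rewrite -sk aut_act //; congr fs_act; apply: funext => i /=.
      pose e : M := SigSub (mem_set (Gamma_M k Gk i)).
      exact: (congr1 (@^~ e) sm).
    have [b1 bb1 xE] : exists2 b', eqtp (fun e : M => val e) b b' & x = fs_act F h1 b'.
      apply: lift; first exact: l'G.
      by move=> chi hchi; apply: qx; rewrite qE.
    have [b2 bb2 yE] : exists2 b', eqtp (fun e : M => val e) b b' & y = fs_act F h' b'.
      by apply: lift => // chi hchi; exact: py.
    by apply: (h'sep h1 b1 b2) => //; rewrite -xE -yE.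
have /choice[y yP] : forall s : set nat, exists y, Y y /\
    tp M y = val (f (fun n => `[< s n >])).
  by move=> s; have [y Yy yE] := set_mem (valP (f (fun n => `[< s n >]))); exists y.
pose cl x := [set x' | Y x' /\ fsE F (x, x')].
have clQ s : cl (y s) \in quotient Y (fsE F).
  by apply/mem_set; exists (y s) => //; exact: (yP s).1.
apply/card_le_sig/(cle_trans (cle_sig _)).
(* Equal classes would put [y s] and [y t] in some [fsU F n], relating by [R n] the types of two
   distinct branches. *)
exists (fun s => SigSub (clQ s)) => s t /(congr1 val) /= st.
apply: contrapT => nst.
have [Ys ys] := yP s; have [Yt yt] := yP t.
have : cl (y t) (y t) by split=> //; apply: fsE_refl; exact: YX.
rewrite -st => -[_ /fsEU[n Un]].
apply: (fP (fun n => `[< s n >]) (fun n => `[< t n >]) _ n).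
  move=> e; apply: nst; apply/funext => k; apply/propext.
  by have /(congr1 is_true) := congr1 (@^~ k) e; rewrite !asboolE => ->.
by exists (y s), (y t); split=> //; [rewrite -ys|rewrite -yt].
Qed.
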